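(* Let $c\in\{0,N\}$ and let $[x_k]=(x_0,\ldots,x_N)$ be a zero-mean nonsingular Gaussian (ZMNG) sequence of $\mathbb{R}^d$-valued random vectors. Then $[x_k]$ is $CM_c$ if and only if it can be represented as $$x_k=y_k+\Gamma_kx_c,\quad k\in[0,N]\setminus\{c\},$$ where $(y_k)_{k\in[0,N]\setminus\{c\}}$ is a ZMNG Markov sequence, $x_c$ is a ZMNG vector uncorrelated with $(y_k)_{k\in[0,N]\setminus\{c\}}$, and $\Gamma_k$, $k\in[0,N]\setminus\{c\}$, are some ($d\times d$) matrices.
   Context: $N$ is a positive integer and $[i,j]=\{i,i+1,\ldots,j\}$; $[x_k]$ denotes $(x_k)_{k\in[0,N]}$. A sequence (or vector) is zero-mean nonsingular Gaussian (ZMNG) if the stacked vector of all its terms is jointly Gaussian with zero mean and nonsingular covariance matrix. For $c=N$ the index set $[0,N]\setminus\{c\}$ is $[0,N-1]$, and for $c=0$ it is $[1,N]$. A sequence indexed by an interval of integers is Markov if, conditioned on the state at any time $k$, the segment before $k$ is independent of the segment after $k$ (sequences of length less than 3 are Markov). A sequence $[x_k]$ is $CM_c$ if, conditioned on $x_c$, the sequence is Markov over $[0,N]\setminus\{c\}$; equivalently, for all $j<k$ in $[0,N]$, the conditional distribution of $x_k$ given $(x_0,\ldots,x_j,x_c)$ equals the conditional distribution of $x_k$ given $(x_j,x_c)$. $CM_N$ is also written $CM_L$, and $CM_0$ is also written $CM_F$. *)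

(* Defs.v *)
From HB Require Import structures.
From mathcomp Require Import all_boot all_order all_algebra.
From mathcomp Require Import all_classical all_reals all_analysis.

Set Implicit Arguments.
Unset Strict Implicit.
Unset Printing Implicit Defensive.

Import Order.TTheory GRing.Theory Num.Theory.
Import numFieldNormedType.Exports.

Local Open Scope classical_set_scope.
Local Open Scope ring_scope.

(** An R^d-valued random vector is given by its coordinates, as a family
    ['I_d -> {RV P >-> R}]; a sequence of n such vectors is a family
    ['I_n -> 'I_d -> {RV P >-> R}]. *)

Section Gaussian.
Context {dT : measure_display} {T : measurableType dT} {R : realType}.
Variable P : probability T R.

(** Degenerate case apart: the library's [normal_prob m 0] is the uniform law
    on [0, 1], not the Dirac mass at [m]. *)
Definition is_normal (f : T -> R) : Prop :=
  (exists m : R, forall A, measurable A -> (P (f @^-1` A) = \d_m A)%E) \/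
  (exists m s : R, 0 < s /\
     forall A, measurable A -> P (f @^-1` A) = normal_prob m s A).

(** Jointly Gaussian: every linear combination is (possibly degenerate)
    normal. *)
Definition jointly_gaussian (J : finType) (X : J -> {RV P >-> R}) : Prop :=
  forall a : J -> R, is_normal (fun w => \sum_(j : J) a j * X j w).

Definition cov_mx (J : finType) (X : J -> {RV P >-> R}) : 'M[R]_#|J| :=
  \matrix_(i, j) fine (covariance P (X (enum_val i)) (X (enum_val j))).

Definition zmng (J : finType) (X : J -> {RV P >-> R}) : Prop :=
  [/\ jointly_gaussian X,
      (forall j, ('E_P[X j] = 0)%E) &
      cov_mx X \in unitmx].

Definition stack (n d : nat) (x : 'I_n -> 'I_d -> {RV P >-> R}) :
    'I_n * 'I_d -> {RV P >-> R} :=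
  fun p => x p.1 p.2.

Definition zmng_seq (n d : nat) (x : 'I_n -> 'I_d -> {RV P >-> R}) : Prop :=
  zmng (stack x).

Definition uncorrelated (I J : Type) (X : I -> {RV P >-> R})
    (Y : J -> {RV P >-> R}) : Prop :=
  forall i j, covariance P (X i) (Y j) = 0%E.

Definition value (d : nat) (X : 'I_d -> {RV P >-> R}) (w : T) : 'cV[R]_d :=
  \col_i X i w.

End Gaussian.

Section ConditionalIndependence.
Context {dT : measure_display} {T : measurableType dT} {R : realType}.
Variable P : probability T R.

(** The sigma-algebra generated by a set of real random variables (the trivial
    one when [F] is empty). *)
Definition sigma_rv (F : set (T -> R)) : set (set T) :=
  <<s [set A | exists2 f, F f & exists2 B, measurable B & A = f @^-1` B] >>.

(** [g] is a version of the conditional probability P(A | G). *)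
Definition is_cond_prob (G : set (set T)) (A : set T) (g : T -> R) : Prop :=
  [/\ (forall B, measurable B -> G (g @^-1` B)),
      P.-integrable setT (EFin \o g) &
      (forall C, G C -> (\int[P]_(w in C) (g w)%:E)%E = P (A `&` C))].

(** P(A /\ B | G) = P(A | G) P(B | G) almost surely, for all A in F1 and
    B in F2.  Versions always exist and are a.s. unique, so it does not matter
    which ones are taken. *)
Definition cond_indep (G F1 F2 : set (set T)) : Prop :=
  forall A B, F1 A -> F2 B ->
    exists gA gB : T -> R,
      [/\ is_cond_prob G A gA, is_cond_prob G B gB &
          is_cond_prob G (A `&` B) (fun w => gA w * gB w)].

Definition coords (d : nat) (X : 'I_d -> {RV P >-> R}) : set (T -> R) :=
  range (fun i => X i : T -> R).

Definition before (n d : nat) (x : 'I_n -> 'I_d -> {RV P >-> R}) (k : 'I_n) :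
    set (T -> R) :=
  \bigcup_(j in [set j : 'I_n | (j < k)%N]) coords (x j).

Definition after (n d : nat) (x : 'I_n -> 'I_d -> {RV P >-> R}) (k : 'I_n) :
    set (T -> R) :=
  \bigcup_(j in [set j : 'I_n | (k < j)%N]) coords (x j).

(** Markov conditionally on the random variables in [F]: given [F] and the
    state at any time [k], past and future are independent. *)
Definition markov_given (F : set (T -> R)) (n d : nat)
    (x : 'I_n -> 'I_d -> {RV P >-> R}) : Prop :=
  forall k : 'I_n,
    cond_indep (sigma_rv (F `|` coords (x k)))
               (sigma_rv (before x k)) (sigma_rv (after x k)).

Definition markov_seq (n d : nat) (x : 'I_n -> 'I_d -> {RV P >-> R}) : Prop :=
  markov_given set0 x.

(** [lift c : 'I_N -> 'I_N.+1] is the increasing enumeration of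
    [0, N] \ {c}. *)
Definition CM (N d : nat) (c : 'I_N.+1)
    (x : 'I_N.+1 -> 'I_d -> {RV P >-> R}) : Prop :=
  markov_given (coords (x c)) (fun k : 'I_N => x (lift c k)).

End ConditionalIndependence.

(* Main.v *)
(* Regressing each x_k on x_c gives y_k = x_k - Gamma_k x_c, uncorrelated with
   x_c and hence, by joint Gaussianity, independent of it. Given x_c, the
   families x and y generate the same sigma-algebras, and conditioning on the
   independent vector x_c does not affect the events of y; so x is Markov given
   x_c exactly when y is Markov.

   That uncorrelated means independent rests on
   E cos(f + g + b) = cos b * E cos f * E cos g for uncorrelated elements f, g
   of the Gaussian space: trigonometric polynomials of the two families are then
   uncorrelated, and so are their bounded pointwise limits, which include the
   indicators of all the events generated by each family. *)

From HB Require Import structures.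
From mathcomp Require Import all_boot all_order all_algebra.
From mathcomp Require Import all_classical all_reals all_analysis.
From mathcomp Require Import measurable_realfun.
From mathcomp Require Import ring lra.
Require Import Defs.

Set Implicit Arguments.
Unset Strict Implicit.
Unset Printing Implicit Defensive.

Import Order.TTheory GRing.Theory Num.Theory.
Import numFieldNormedType.Exports.

Local Open Scope classical_set_scope.
Local Open Scope ring_scope.

(** * Conditional probabilities and conditional independence *)

Section ConditionalProbability.
Context {dT : measure_display} {T : measurableType dT} {R : realType}.
Variable P : probability T R.
Implicit Types (G F K : set (set T)) (A B C : set T) (g h : T -> R).

(** Conditional independence is expressed through versions of conditional probabilities, so every
    change of the conditioning sigma-algebra means showing that a version for one is a version for
    another. Versions come from the Radon-Nikodym theorem, and two of them are compared inside a
    larger sigma-algebra for which both are versions. The representation holds only almost surely,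
    so a given y need not be measurable with respect to the sigma-algebra of x; sigma-algebras
    therefore also have to be compared up to null sets. The cosine identity comes from real analysis
    on the line: for uncorrelated f and g variances add, so f + g has the law of a sum of
    independent centered normals, and normal densities convolve explicitly. To reach indicators from
    cosines, the class of limits is shown to be closed under products; odd polynomials converging to
    the sign function can then be applied to its members. *)

Lemma ge0_integral_mrestr (A D : set T) (mA : measurable A) (f : T -> \bar R) :
  measurable D -> measurable_fun [set: T] f -> (forall w, (0 <= f w)%E) ->
  (\int[mrestr P mA]_(w in D) f w = \int[P]_(w in A `&` D) f w)%E.
Proof.
move=> mD mf f0; have mA' : measurable (~` A) by exact: measurableC.
have fA0 w : (0 <= (f \_ A) w)%E by exact: erestrict_ge0.
have mfA : measurable_fun [set: T] (f \_ A).
  by apply/(measurable_restrictT f mA); exact: measurable_funTS.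
transitivity (\int[mrestr P mA]_(w in D) (f \_ A) w)%E.
  apply: ge0_ae_eq_integral => //.
  - exact: measurable_funTS.
  - exact: measurable_funTS.
  exists (~` A); split => //=.
    by rewrite /mrestr setICl measure0.
  move=> w /= ne Aw; apply: ne => _; rewrite patchE mem_set//.
(* [P] is the sum of its restrictions to [A] and to the complement of [A], and the integral of
   [f \_ A] against the second one vanishes. *)
have <- : (\int[P]_(w in D) (f \_ A) w = \int[mrestr P mA]_(w in D) (f \_ A) w)%E.
  rewrite (eq_measure_integral (measure_add (mrestr P mA) (mrestr P mA')));
    last first.
    move=> B mB _; rewrite /measure_add/= /msum/= big_ord_recl big_ord1/=;
      transitivity (P (B `&` A) + P (B `&` ~` A))%E => //.
    rewrite -measureU//; [|exact: measurableI|exact: measurableI|].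
      by rewrite -setIUr setUv setIT.
    by rewrite setIACA setICr setI0.
  rewrite ge0_integral_measure_add//; last exact: measurable_funTS.
  rewrite [X in (_ + X)%E](_ : _ = 0%E) ?adde0//.
  transitivity (\int[mrestr P mA']_(w in D) (cst 0%E w : \bar R))%E;
    last exact: integral0.
  apply: ge0_ae_eq_integral => //; first exact: measurable_funTS.
  exists A; split => //=.
    by rewrite /mrestr setICr measure0.
  move=> w /= ne; apply: contrapT => nA; apply: ne => _; rewrite patchE memNset//.
by rewrite setIC integral_mkcondr.
Qed.

(** Phrased for a bare family of sets, exactly as the measurability clause of [is_cond_prob]. *)
Definition measurable_wrt G g := forall B : set R, measurable B -> G (g @^-1` B).

Lemma measurable_wrtP G g : sigma_algebra setT G ->
  measurable_wrt G g <-> measurable_fun [set: g_sigma_algebraType G] g.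
Proof.
move=> sG; split=> [mg _ B mB|mg B mB].
  by rewrite setTI; apply: sub_sigma_algebra; exact: mg.
have := mg measurableT B mB; rewrite setTI.
by rewrite /measurable/= (sigma_algebra_id sG).
Qed.

Lemma sigma_algebraT G : sigma_algebra setT G -> G setT.
Proof. by case=> G0 GC _; rewrite -[setT](setD0 setT); exact: GC. Qed.

Lemma sigma_algebraI G A B : sigma_algebra setT G -> G A -> G B -> G (A `&` B).
Proof.
move=> sG; have <- : (measurable : set (set (g_sigma_algebraType G))) = G.
  by rewrite /measurable/= (sigma_algebra_id sG).
exact: measurableI.
Qed.

Lemma measurable_sub_id G : sigma_algebra setT G -> G `<=` measurable ->
  measurable_fun [set: T] (id : T -> g_sigma_algebraType G).
Proof.
move=> sG Gm _ B; rewrite setTI /measurable/= (sigma_algebra_id sG) => GB.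
exact: Gm.
Qed.

(** The Radon-Nikodym derivative of P(A and .) with respect to [P], both restricted to [G] by
    pushing them forward along the identity. The last clause, pulling a nonnegative [G]-measurable
    factor out of the conditioning, is the change of variables for that derivative and drives the
    proofs about conditional independence. *)
Lemma cond_prob_exists G A : sigma_algebra setT G -> G `<=` measurable ->
  measurable A ->
  exists g, [/\ forall w, 0 <= g w, is_cond_prob P G A g &
    forall h C, G C -> (forall w, 0 <= h w) -> measurable_wrt G h ->
      (\int[P]_(w in C) (h w * g w)%:E = \int[P]_(w in A `&` C) (h w)%:E)%E].
Proof.
move=> sG Gm mA.
have GE : (measurable : set (set (g_sigma_algebraType G))) = G.
  by rewrite /measurable/= (sigma_algebra_id sG).
have Gm' (B : set (g_sigma_algebraType G)) :
  measurable B -> dT.-measurable (B : set T) by rewrite GE; exact: Gm.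
pose i : T -> g_sigma_algebraType G := id.
have mi : measurable_fun [set: T] i.
  by move=> _ B; rewrite setTI GE; exact: Gm.
pose X : {mfun T >-> g_sigma_algebraType G} :=
  HB.pack i (isMeasurableFun.Build _ _ _ _ i mi).
pose mu := distribution P X.
pose pf :
  {measure set (g_sigma_algebraType G) -> \bar R} := pushforward (mrestr P mA) i.
pose nu0 := pf mi.
have nufin : fin_num_fun nu0.
  move=> B mB; rewrite /nu0/= /pushforward /mrestr fin_num_measure//.
  by apply: measurableI => //; exact: Gm'.
pose nu : {finite_measure set (g_sigma_algebraType G) -> \bar R} :=
  HB.pack (nu0 : set _ -> \bar R) (Measure.class nu0)
    (Measure_isFinite.Build _ _ _ nu0 nufin).
have numu : nu `<< mu.
  apply/null_content_dominatesP => B mB;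
    rewrite /mu/nu/= /distribution /pushforward /mrestr => B0.
  apply/eqP; rewrite eq_le measure_ge0 andbT -[leRHS]B0.
  have mB' : dT.-measurable (X @^-1` B) by exact: Gm'.
  by apply: le_measure => //; rewrite inE//; exact: measurableI.
pose f := Radon_Nikodym_SigmaFinite.f nu mu.
have f0 w : (0 <= f w)%E by exact: Radon_Nikodym_SigmaFinite.f_ge0.
have ffin w : f w \is a fin_num by exact: Radon_Nikodym_SigmaFinite.f_fin_num.
have intf : mu.-integrable setT f by exact: Radon_Nikodym_SigmaFinite.f_integrable.
pose g := fine \o f.
have gE : EFin \o g = f by apply/funext => w /=; rewrite fineK.
have mf : measurable_fun [set: g_sigma_algebraType G] f.
  exact: measurable_int intf.
have mg : measurable_fun [set: g_sigma_algebraType G] g.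
  by apply/measurable_EFinP; rewrite gE.
have GC C : G C -> measurable (C : set (g_sigma_algebraType G)) by rewrite GE.
have key h C : G C -> (forall w, 0 <= h w) -> measurable_wrt G h ->
    (\int[P]_(w in C) (h w * g w)%:E = \int[P]_(w in A `&` C) (h w)%:E)%E.
  move=> CG h0 /(measurable_wrtP _ sG) mh.
  have mh' : measurable_fun [set: g_sigma_algebraType G] (EFin \o h).
    exact/measurable_EFinP.
  have mCG := GC _ CG.
  have mhP : measurable_fun [set: T] (EFin \o h).
    by move=> _ B mB; rewrite setTI; apply: Gm'; rewrite -[_ @^-1` _]setTI;
      exact: mh'.
  have mfP : measurable_fun [set: T] f.
    by move=> _ B mB; rewrite setTI; apply: Gm'; rewrite -[_ @^-1` _]setTI;
      exact: mf.
  transitivity (\int[mu]_(w in C) ((h w)%:E * f w))%E.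
    rewrite /mu /distribution ge0_integral_pushforward//; last 2 first.
    - apply: emeasurable_funM; exact: measurable_funTS.
    - by move=> w _; apply: mule_ge0; [rewrite lee_fin|exact: f0].
    by apply: eq_integral => w _ /=; rewrite EFinM fineK.
  transitivity (\int[nu]_(w in C) (h w)%:E)%E.
    apply: (Radon_Nikodym_SigmaFinite.change_of_variables numu) => //.
    exact: measurable_funTS.
  transitivity (\int[mrestr P mA]_(w in C) (h w)%:E)%E.
    rewrite /nu/= ge0_integral_pushforward//=.
    - exact: measurable_funTS.
    - by move=> w _; rewrite lee_fin.
  by rewrite ge0_integral_mrestr//; exact: Gm.
exists g; split => //.
- by move=> w; rewrite fine_ge0.
split.
- exact/(measurable_wrtP _ sG).
- rewrite gE.
  have := intf; rewrite /mu /distribution => /integrableP[_ ifin].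
  apply/integrableP; split.
    by move=> _ B mB; rewrite setTI; apply: Gm'; rewrite -[_ @^-1` _]setTI;
      exact: mf.
  move: ifin; rewrite ge0_integral_pushforward//.
  exact: measurableT_comp.
- move=> C CG; have /(_ _)/= := key (cst 1) C CG.
  under eq_integral do rewrite mul1r.
  move=> ->//.
    by rewrite integral_cst ?mul1e//; apply: measurableI => //; exact: Gm.
  by apply/(measurable_wrtP _ sG); exact: measurable_cst.
Qed.

(** Equality of integrals is known over sets of [G] only, so the comparison is made for [P]
    restricted to [G]; the exceptional set found there lies in [G] and is null for [P]. *)
Lemma cond_prob_ae_unique G A g h : sigma_algebra setT G -> G `<=` measurable ->
  is_cond_prob P G A g -> is_cond_prob P G A h -> ae_eq P setT g h.
Proof.
move=> sG Gm [mg ig Eg] [mh ih Eh].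
pose i : T -> g_sigma_algebraType G := id.
have mi : measurable_fun [set: T] i by exact: measurable_sub_id.
pose X : {mfun T >-> g_sigma_algebraType G} :=
  HB.pack i (isMeasurableFun.Build _ _ _ _ i mi).
pose mu := distribution P X.
have GE : (measurable : set (set (g_sigma_algebraType G))) = G.
  by rewrite /measurable/= (sigma_algebra_id sG).
have int_mu (k : T -> R) : measurable_wrt G k -> P.-integrable setT (EFin \o k) ->
    mu.-integrable setT (EFin \o k) /\
    forall C, G C -> (\int[mu]_(w in C) (k w)%:E = \int[P]_(w in C) (k w)%:E)%E.
  move=> /(measurable_wrtP _ sG) mk ik; split.
    apply: integrable_pushforward => //; exact/measurable_EFinP.
  move=> C CG; rewrite integral_pushforward//.
  - exact/measurable_EFinP.
  - by apply: integrableS ik => //; exact: Gm.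
  - by rewrite GE.
have [ig' Eg'] := int_mu _ mg ig; have [ih' Eh'] := int_mu _ mh ih.
have [N [mN N0 sN]] : ae_eq mu setT (EFin \o g) (EFin \o h).
  apply: integral_ae_eq => //; first exact: measurable_int ih'.
  by move=> E _; rewrite GE => GE'; rewrite Eg'// Eh'// Eg// Eh.
exists N; split => //.
  by apply: Gm; rewrite -GE.
move=> w /= ne; apply: sN => /= E; apply: ne => wT.
by case: (E wT).
Qed.

Lemma is_cond_prob_ae G A g h : sigma_algebra setT G -> G `<=` measurable ->
  is_cond_prob P G A g -> measurable_wrt G h -> ae_eq P setT g h ->
  is_cond_prob P G A h.
Proof.
move=> sG Gm [mg ig Eg] mh gh.
have mwP k : measurable_wrt G k -> measurable_fun [set: T] (EFin \o k).
  move=> mk; apply/measurable_EFinP => _ B mB.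
  by rewrite setTI; apply: Gm; exact: mk.
have ghE : ae_eq P setT (EFin \o g) (EFin \o h) by exact: ae_eq_comp gh.
split => //.
- move/integrableP : ig => [mgP ig]; apply/integrableP; split; first exact: mwP.
  rewrite (ae_eq_integral (abse \o (EFin \o g)))//.
  - by apply: measurableT_comp => //; exact: mwP.
  - by apply: measurableT_comp => //; exact: mwP.
  - exact/ae_eq_sym/ae_eq_abse.
- move=> C GC; rewrite -Eg//; apply: ae_eq_integral => //.
  - exact: Gm.
  - exact/measurable_funTS/mwP.
  - exact/measurable_funTS/mwP.
  - exact/ae_eq_sym/(ae_eq_subset (@subsetT _ C)).
Qed.

Lemma measurable_wrtM G g h : sigma_algebra setT G ->
  measurable_wrt G g -> measurable_wrt G h ->
  measurable_wrt G (fun w => g w * h w).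
Proof.
move=> sG /(measurable_wrtP _ sG) mg /(measurable_wrtP _ sG) mh.
exact/(measurable_wrtP _ sG)/measurable_funM.
Qed.

(** A pi-lambda argument: intersections of a set of [G] with a set of [F] are stable under
    intersection and generate the join, while the sets over which [g] has the right integral form a
    lambda-system. *)
Lemma is_cond_prob_join G F A g : sigma_algebra setT G -> sigma_algebra setT F ->
  G `<=` measurable -> F `<=` measurable -> measurable A ->
  is_cond_prob P G A g ->
  (forall D E, G D -> F E ->
    (\int[P]_(w in D `&` E) (g w)%:E = P (A `&` (D `&` E)))%E) ->
  is_cond_prob P <<s G `|` F >> A g.
Proof.
move=> sG sF Gm Fm mA [mg ig Eg] rect.
have GK : G `<=` <<s G `|` F >> by move=> B GB; apply: sub_sigma_algebra; left.
split => //; first by move=> B mB; apply: GK; exact: mg.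
pose RE := [set C | exists D E, [/\ G D, F E & C = D `&` E]].
have sK : sigma_algebra setT <<s G `|` F >> by exact: smallest_sigma_algebra.
have -> : <<s G `|` F >> = <<s RE >>.
  apply/seteqP; split; apply: smallest_sub => //;
      try exact: smallest_sigma_algebra.
    move=> B [GB|FB]; apply: sub_sigma_algebra.
      by exists B, setT; rewrite setIT; split => //; exact: sigma_algebraT.
    by exists setT, B; rewrite setTI; split => //; exact: sigma_algebraT.
  move=> _ [D [E [GD FE ->]]]; apply: (sigma_algebraI sK).
    exact: GK.
  by apply: sub_sigma_algebra; right.
have REm : RE `<=` dT.-measurable.
  by move=> _ [D [E [GD FE ->]]]; apply: measurableI; [exact: Gm|exact: Fm].
suff : <<s RE >> `<=` [set C | measurable C /\
    (\int[P]_(w in C) (g w)%:E)%E = P (A `&` C)].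
  by move=> H C /H[].
apply: lambda_system_subset.
- move=> _ _ [D1 [E1 [GD1 FE1 ->]]] [D2 [E2 [GD2 FE2 ->]]].
  exists (D1 `&` D2), (E1 `&` E2); rewrite setIACA; split => //.
    exact: (sigma_algebraI sG).
  exact: (sigma_algebraI sF).
- apply/dynkin_lambda_system; split.
  + split => //; rewrite -[setT](setIT setT).
    by apply: rect; [exact: (sigma_algebraT sG)|exact: (sigma_algebraT sF)].
  + move=> C [mC EC]; split; first exact: measurableC.
    have := rect _ _ (sigma_algebraT sG) (sigma_algebraT sF).
    rewrite !setIT -{1}(setUv C) integral_setU//=; last 3 first.
    * exact: measurableC.
    * rewrite setUv; exact: (measurable_int P ig).
    * by rewrite disj_set2E setICr.
    rewrite EC -[in RHS](setIT A) -{1}(setUv C) setIUr measureU//; last 3 first.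
    * exact: measurableI.
    * by apply: measurableI => //; exact: measurableC.
    * by rewrite setIACA setICr setI0.
    move=> /(congr1 (fun z => z - P (A `&` C))%E).
    by rewrite ![(P (A `&` C) + _)%E]addeC !addeK// fin_num_measure//;
      exact: measurableI.
  + move=> B tB HB; have mB n : measurable (B n) by case: (HB n).
    split; first exact: bigcup_measurable.
    rewrite integral_bigcup//; last first.
      by apply: integrableS ig => //; exact: bigcup_measurable.
    rewrite setI_bigcupr measure_bigcup//.
    * rewrite (@eq_eseriesl _ _ (fun n => n \in [set: nat])); last first.
        by move=> n; rewrite in_setT.
      by apply: eq_eseriesr => n _; case: (HB n).
    * by move=> n _; exact: measurableI.
    * exact: trivIset_setIl.
- move=> _ [D [E [GD FE ->]]]; split; last exact: rect.
  by apply: measurableI; [exact: Gm|exact: Fm].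
- by [].
Qed.

Lemma cond_indepC G F1 F2 : cond_indep P G F1 F2 -> cond_indep P G F2 F1.
Proof.
move=> CI A B FA FB; have [gB [gA [cB cA cAB]]] := CI B A FB FA.
exists gA, gB; split => //; rewrite setIC.
by rewrite (_ : (fun w => _) = (fun w => gB w * gA w))//; apply/funext => w;
  rewrite mulrC.
Qed.

Lemma cond_indep_sub G F1 F2 F1' F2' : F1' `<=` F1 -> F2' `<=` F2 ->
  cond_indep P G F1 F2 -> cond_indep P G F1' F2'.
Proof. by move=> s1 s2 CI A B /s1 FA /s2 FB; exact: CI. Qed.

(* If [gA] and [gB] are versions of P(A | G) and P(B | G) then, [gB] being
   G-measurable, gA * gB integrates over C in G as [gB] over A /\ C; so the
   hypothesis says that [gB] is also a version of P(B | G \/ F1). *)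
Lemma cond_indep_joinl G F1 F2 : sigma_algebra setT G ->
  sigma_algebra setT F1 -> G `<=` measurable -> F1 `<=` measurable ->
  F2 `<=` measurable ->
  cond_indep P G F1 F2 -> cond_indep P G <<s G `|` F1 >> F2.
Proof.
move=> sG sF1 Gm F1m F2m CI A B FA FB.
have sK : sigma_algebra setT <<s G `|` F1 >> by exact: smallest_sigma_algebra.
have Km : <<s G `|` F1 >> `<=` dT.-measurable.
  apply: smallest_sub; first exact: sigma_algebra_measurable.
  by move=> C [/Gm|/F1m].
have [gB [gB0 cB _]] := cond_prob_exists sG Gm (F2m _ FB).
have [gA [gA0 cA pullA]] := cond_prob_exists sG Gm (Km _ FA).
have [mgA iA _] := cA; have [mgB iB EB] := cB.
have cBK : is_cond_prob P <<s G `|` F1 >> B gB.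
  apply: is_cond_prob_join => //; first exact: F2m.
  move=> D E GD FE.
  have [hE [hB [cE' cB' cEB']]] := CI E B FE FB.
  have [gE [gE0 cE pullE]] := cond_prob_exists sG Gm (F1m _ FE).
  have [mgE _ _] := cE.
  have [] := is_cond_prob_ae (h := fun w => gB w * gE w) sG Gm cEB'.
  - exact: measurable_wrtM.
  - have aE := cond_prob_ae_unique sG Gm cE' cE.
    have aB := cond_prob_ae_unique sG Gm cB' cB.
    by apply: filterS2 aE aB => w eE eB wT; rewrite eE// eB// mulrC.
  move=> _ _ /(_ D GD); rewrite pullE// [D `&` E]setIC => ->.
  by congr (P _); rewrite [E `&` B]setIC setIA.
have [_ _ EBK] := cBK.
exists gA, gB; split => //.
have mAB : measurable_wrt G (fun w => gA w * gB w) by exact: measurable_wrtM.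
have EAB C : G C -> (\int[P]_(w in C) (gA w * gB w)%:E = P (A `&` B `&` C))%E.
  move=> GC; under eq_integral do rewrite mulrC.
  rewrite pullA// EBK.
    by congr (P _); rewrite setIA [B `&` A]setIC.
  by apply: (sigma_algebraI sK) => //; apply: sub_sigma_algebra; left.
split => //; apply/integrableP; split.
  apply/measurable_EFinP => _ C mC; rewrite setTI; apply: Gm; exact: mAB.
under eq_integral do rewrite /= ger0_norm ?mulr_ge0//.
by rewrite EAB ?ltey_eq ?fin_num_measure//; [apply: measurableI;
  [apply: measurableI; [exact: Km|exact: F2m]|]|exact: sigma_algebraT].
Qed.

(* [H] collects the events on which conditioning on [G], on [G'] and on the
   larger [K] are all the same. *)
Lemma cond_indep_change G G' K H F1 F2 :
  sigma_algebra setT G' -> sigma_algebra setT K ->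
  G' `<=` K -> K `<=` measurable -> H `<=` measurable -> setI_closed H ->
  F1 `<=` H -> F2 `<=` H ->
  (forall A g, H A -> is_cond_prob P G A g -> is_cond_prob P K A g) ->
  (forall A g, H A -> is_cond_prob P G' A g -> is_cond_prob P K A g) ->
  cond_indep P G F1 F2 -> cond_indep P G' F1 F2.
Proof.
move=> sG' sK G'K Km Hm HI F1H F2H GK GK' CI A B FA FB.
have G'm : G' `<=` measurable by apply: subset_trans Km.
have [HA HB] := (F1H _ FA, F2H _ FB).
have [hA [hB [cA cB cAB]]] := CI A B FA FB.
have [gA [gA0 cA' _]] := cond_prob_exists sG' G'm (Hm _ HA).
have [gB [_ cB' _]] := cond_prob_exists sG' G'm (Hm _ HB).
have [mgA _ _] := cA'; have [mgB _ _] := cB'.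
exists gA, gB; split => //.
have mAB : measurable_wrt G' (fun w => gA w * gB w) by exact: measurable_wrtM.
(* Seen from [K], the given versions and the [G']-measurable ones are versions of the same
   conditional probabilities, hence agree almost everywhere; the product rule passes to the latter
   and is then restricted from [K] to [G']. *)
have {}cAB := GK _ _ (HI _ _ HA HB) cAB.
have aA := cond_prob_ae_unique sK Km (GK _ _ HA cA) (GK' _ _ HA cA').
have aB := cond_prob_ae_unique sK Km (GK _ _ HB cB) (GK' _ _ HB cB').
have mABK : measurable_wrt K (fun w => gA w * gB w).
  by move=> C mC; apply: G'K; exact: mAB.
have [] := is_cond_prob_ae sK Km cAB mABK.
  by apply: filterS2 aA aB => w eA eB wT; rewrite eA// eB.
by move=> _ iAB EAB; split => // C /G'K; exact: EAB.
Qed.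

Definition indep_sets F K := forall A B, F A -> K B ->
  (P (A `&` B) = P A * P B)%E.

(* An event independent of [G] has the constant P(E) as conditional probability,
   so by pull-out it factors out of integrals of G-measurable functions. *)
Lemma is_cond_prob_indep G F H A g : sigma_algebra setT G ->
  sigma_algebra setT F -> setI_closed H -> G `<=` H -> H `<=` measurable ->
  F `<=` measurable -> indep_sets H F -> H A ->
  is_cond_prob P G A g -> is_cond_prob P <<s G `|` F >> A g.
Proof.
move=> sG sF HI GH Hm Fm ind HA cg.
have Gm : G `<=` measurable by exact: subset_trans Hm.
have sK : sigma_algebra setT <<s G `|` F >> by exact: smallest_sigma_algebra.
have Km : <<s G `|` F >> `<=` dT.-measurable.
  apply: smallest_sub; first exact: sigma_algebra_measurable.
  by move=> C [/Gm|/Fm].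
have GK : G `<=` <<s G `|` F >> by move=> B GB; apply: sub_sigma_algebra; left.
(* A nonnegative version replaces [g], because the pull-out formula is stated for nonnegative
   factors. *)
have [k [k0 ck _]] := cond_prob_exists sG Gm (Hm _ HA).
have [mk ik Ek] := ck.
have [mg _ _] := cg.
have mgK : measurable_wrt <<s G `|` F >> g by move=> B mB; apply: GK; exact: mg.
apply: (is_cond_prob_ae (g := k)) => //;
  last exact: (cond_prob_ae_unique sG Gm ck cg).
apply: is_cond_prob_join => //; first exact: Hm.
move=> D E GD FE.
have [e [e0 ce pulle]] := cond_prob_exists sG Gm (Fm _ FE).
have [me ie _] := ce.
have cE : is_cond_prob P G E (cst (fine (P E))).
  split.
  - by apply/(measurable_wrtP _ sG); exact: measurable_cst.
  - exact: finite_measure_integrable_cst.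
  - move=> C GC; have [PE PC] := (Fm _ FE, Gm _ GC).
    rewrite /= integral_cst// fineK ?fin_num_measure//.
    by rewrite setIC ind//; [rewrite muleC|exact: GH].
rewrite setIC -pulle//.
have mkP : measurable_fun [set: T] k.
  by move=> _ B mB; rewrite setTI; apply: Gm; exact: mk.
have meP : measurable_fun [set: T] e.
  by move=> _ B mB; rewrite setTI; apply: Gm; exact: me.
transitivity (\int[P]_(w in D) ((fine (P E))%:E * (k w)%:E))%E.
  apply: ae_eq_integral.
  - exact: Gm.
  - apply/measurable_EFinP/measurable_funTS; exact: measurable_funM.
  - apply/measurable_funTS; apply: emeasurable_funM => //; exact/measurable_EFinP.
  - have := cond_prob_ae_unique sG Gm ce cE.
    by apply: filterS => w /(_ I) -> _; rewrite -EFinM mulrC.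
rewrite integralZl//; last 2 first.
- exact: Gm.
- by apply: integrableS ik => //; exact: Gm.
rewrite Ek// fineK ?fin_num_measure//; last exact: Fm.
rewrite muleC [E `&` D]setIC setIA (ind (A `&` D) E)//.
by apply: HI => //; exact: GH.
Qed.

(** * Modification of events on null sets *)

Local Notation ae_eq_sets A B := {ae P, forall w, (A : set T) w <-> (B : set T) w}.

Lemma ae_eq_sets_integral A B (f : T -> \bar R) : measurable A -> measurable B ->
  measurable_fun [set: T] f -> ae_eq_sets A B ->
  (\int[P]_(w in A) f w = \int[P]_(w in B) f w)%E.
Proof.
move=> mA mB mf AB; rewrite integral_mkcond [RHS]integral_mkcond.
apply: ae_eq_integral => //.
- by apply/(measurable_restrictT f mA); exact: measurable_funTS.
- by apply/(measurable_restrictT f mB); exact: measurable_funTS.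
- apply: filterS AB => w AB _; rewrite !patchE.
  have -> // : (w \in A) = (w \in B).
  by apply/idP/idP; rewrite !inE => /AB.
Qed.

Lemma ae_eq_sets_measure A B : measurable A -> measurable B ->
  ae_eq_sets A B -> P A = P B.
Proof.
move=> mA mB AB; have := ae_eq_sets_integral mA mB (measurable_cst 1%E) AB.
by rewrite !integral_cst// !mul1e.
Qed.

(** The completion of [G] by null sets, cut down to measurable sets so that it can be the larger
    sigma-algebra [K] of [cond_indep_change]. *)
Definition ae_closure G :=
  [set A | measurable A /\ exists2 B, G B & ae_eq_sets A B].

Lemma sigma_algebra_ae_closure G : sigma_algebra setT G ->
  sigma_algebra setT (ae_closure G).
Proof.
move=> [G0 GC GU]; split.
- by split => //; exists set0 => //; apply: aeW.
- move=> A [mA [B GB AB]]; split; first exact: measurableD.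
  exists (setT `\` B); first exact: GC.
  by apply: filterS AB => w AB; split => -[_ nw]; split => // /AB.
- move=> A HA; split.
    by apply: bigcupT_measurable => n; case: (HA n).
  have /choice[B HB] : forall n, exists B, G B /\ ae_eq_sets (A n) B.
    by move=> n; have [_ [B GB AB]] := HA n; exists B.
  exists (\bigcup_k B k); first by apply: GU => n; case: (HB n).
  have : {ae P, forall w, forall n, A n w <-> B n w}.
    by apply: ae_foralln => n; case: (HB n).
  by apply: filterS => w AB; split => -[n _ /AB nw]; exists n.
Qed.

Lemma sub_ae_closure G : G `<=` measurable -> G `<=` ae_closure G.
Proof. by move=> Gm A GA; split; [exact: Gm|exists A => //; exact: aeW]. Qed.

Lemma is_cond_prob_ae_closure G A g : G `<=` measurable -> measurable A ->
  is_cond_prob P G A g -> is_cond_prob P (ae_closure G) A g.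
Proof.
move=> Gm mA [mg ig Eg]; split => //.
  by move=> B mB; apply: sub_ae_closure => //; exact: mg.
move=> D [mD [C GC DC]].
rewrite (ae_eq_sets_integral mD (Gm _ GC) _ DC); last exact: measurable_int ig.
rewrite Eg//; apply: ae_eq_sets_measure.
- by apply: measurableI => //; exact: Gm.
- exact: measurableI.
- by apply: filterS DC => w DC; split => -[? ?]; split => //; exact/DC.
Qed.

(** Almost everywhere equal events have the same versions, which settles the change of the two
    families. The conditioning sigma-algebras are compared inside the completion of [G']: a version
    given [G] remains one there, since each set of that completion agrees almost everywhere with a
    set of [G]. *)
Lemma cond_indep_ae G G' F1 F2 F1' F2' : sigma_algebra setT G' ->
  G `<=` measurable -> G' `<=` measurable ->
  F1 `<=` measurable -> F2 `<=` measurable ->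
  G `<=` ae_closure G' -> G' `<=` ae_closure G ->
  F1' `<=` ae_closure F1 -> F2' `<=` ae_closure F2 ->
  cond_indep P G F1 F2 -> cond_indep P G' F1' F2'.
Proof.
move=> sG' Gm G'm F1m F2m GG' G'G F1F F2F CI.
have {}CI : cond_indep P G F1' F2'.
  have tr A B g : measurable A -> measurable B -> ae_eq_sets B A ->
      is_cond_prob P G A g -> is_cond_prob P G B g.
    move=> mA mB BA [mg ig Eg]; split => // C GC; rewrite Eg//.
    apply: ae_eq_sets_measure.
    - by apply: measurableI => //; exact: Gm.
    - by apply: measurableI => //; exact: Gm.
    - by apply: filterS BA => w BA; split => -[? ?]; split => //; exact/BA.
  move=> A' B' /F1F[mA' [A FA AA']] /F2F[mB' [B FB BB']].
  have [gA [gB [cA cB cAB]]] := CI A B FA FB.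
  have [mA mB] := (F1m _ FA, F2m _ FB).
  exists gA, gB; split; [exact: tr cA|exact: tr cB|].
  apply: tr cAB; [exact: measurableI|exact: measurableI|].
  by apply: filterS2 AA' BB' => w AA' BB'; split => -[/AA' ? /BB' ?].
apply: (cond_indep_change (K := ae_closure G') (H := measurable)) CI => //.
- exact: sigma_algebra_ae_closure.
- exact: sub_ae_closure.
- by move=> A [].
- by move=> A B; exact: measurableI.
- by move=> A /F1F[].
- by move=> A /F2F[].
- move=> A g mA [mg ig Eg]; split => //.
    by move=> B mB; apply: GG'; exact: mg.
  move=> D [mD [C GC DC]].
  have [_ [E GE CE]] := G'G _ GC.
  have DE : ae_eq_sets D E.
    by apply: filterS2 DC CE => w DC CE; split => [/DC/CE|/CE/DC].
  rewrite (ae_eq_sets_integral mD (Gm _ GE) _ DE); last exact: measurable_int ig.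
  rewrite Eg//; apply: ae_eq_sets_measure.
  + by apply: measurableI => //; exact: Gm.
  + exact: measurableI.
  + by apply: filterS DE => w DE; split => -[? ?]; split => //; exact/DE.
- by move=> A g mA; exact: is_cond_prob_ae_closure.
Qed.

End ConditionalProbability.

(** * Sigma-algebras generated by random variables *)

Section SigmaRV.
Context {dT : measure_display} {T : measurableType dT} {R : realType}.
Variable P : probability T R.
Implicit Types (F X Y Z : set (T -> R)) (G K : set (set T)).

Lemma sigma_algebra_sigma_rv F : sigma_algebra setT (sigma_rv F).
Proof. exact: smallest_sigma_algebra. Qed.

Lemma measurable_wrt_sigma_rv F f : F f -> measurable_wrt (sigma_rv F) f.
Proof. by move=> Ff B mB; apply: sub_sigma_algebra; exists f => //; exists B. Qed.

Lemma sigma_rv_sub F G : sigma_algebra setT G ->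
  (forall f, F f -> measurable_wrt G f) -> sigma_rv F `<=` G.
Proof.
move=> sG FG; apply: smallest_sub => //.
by move=> _ [f Ff [B mB ->]]; exact: FG.
Qed.

Lemma sigma_rv_measurable F : (forall f, F f -> measurable_fun [set: T] f) ->
  sigma_rv F `<=` dT.-measurable.
Proof.
move=> mF; apply: sigma_rv_sub; first exact: sigma_algebra_measurable.
by move=> f /mF mf B mB; rewrite -[_ @^-1` _]setTI; exact: mf.
Qed.

Lemma sigma_rvS F F' : F `<=` F' -> sigma_rv F `<=` sigma_rv F'.
Proof.
move=> FF'; apply: sigma_rv_sub; first exact: sigma_algebra_sigma_rv.
by move=> f /FF'; exact: measurable_wrt_sigma_rv.
Qed.

Lemma sigma_rvU F F' :
  sigma_rv (F `|` F') = <<s sigma_rv F `|` sigma_rv F' >>.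
Proof.
apply/seteqP; split.
  apply: sigma_rv_sub; first exact: smallest_sigma_algebra.
  move=> f [Ff|Ff] B mB; apply: sub_sigma_algebra; [left|right];
    exact: measurable_wrt_sigma_rv.
apply: smallest_sub; first exact: sigma_algebra_sigma_rv.
by move=> A [|]; apply: sigma_rvS => f ?; [left|right].
Qed.

Lemma sigma_rv_ae F F' : (forall f, F f -> measurable_fun [set: T] f) ->
  (forall f, F f -> exists2 f', F' f' & ae_eq P setT f f') ->
  sigma_rv F `<=` ae_closure P (sigma_rv F').
Proof.
move=> mF FF'; apply: sigma_rv_sub.
  exact/sigma_algebra_ae_closure/sigma_algebra_sigma_rv.
move=> f Ff B mB; split.
  by rewrite -[_ @^-1` _]setTI; exact: mF.
have [f' F'f' ff'] := FF' _ Ff.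
exists (f' @^-1` B); first exact: measurable_wrt_sigma_rv.
by apply: filterS ff' => w /(_ I) /= ->.
Qed.

(** What is known from [K] may be adjoined to either side: [cond_indep_joinl] does it for one side,
    and symmetry for the other. *)
Lemma cond_indep_subjoin K G1 G2 G1' G2' : sigma_algebra setT K ->
  sigma_algebra setT G1 -> sigma_algebra setT G2 ->
  K `<=` measurable -> G1 `<=` measurable -> G2 `<=` measurable ->
  G1' `<=` <<s K `|` G1 >> -> G2' `<=` <<s K `|` G2 >> ->
  cond_indep P K G1 G2 -> cond_indep P K G1' G2'.
Proof.
move=> sK sG1 sG2 Km G1m G2m s1 s2 CI.
apply/cond_indepC/(cond_indep_sub s2 s1).
apply: cond_indep_joinl => //.
  apply: smallest_sub; first exact: sigma_algebra_measurable.
  by move=> C [/Km|/G1m].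
by apply/cond_indepC; exact: cond_indep_joinl.
Qed.

(* Given [Z], the family [X] and its translate [Y] by a function of [Z] carry
   the same information; and when [Z] is independent of [Y], conditioning on
   it has no effect on the events of [Y]. *)
Lemma cond_indep_translate Z X0 X1 X2 Y0 Y1 Y2 :
  (forall f, (Z `|` (X0 `|` X1 `|` X2) `|` (Y0 `|` Y1 `|` Y2)) f ->
     measurable_fun [set: T] f) ->
  (forall f, Y0 f -> measurable_wrt (sigma_rv (Z `|` X0)) f) ->
  (forall f, Y1 f -> measurable_wrt (sigma_rv (Z `|` X1)) f) ->
  (forall f, Y2 f -> measurable_wrt (sigma_rv (Z `|` X2)) f) ->
  (forall f, X0 f -> measurable_wrt (sigma_rv (Z `|` Y0)) f) ->
  (forall f, X1 f -> measurable_wrt (sigma_rv (Z `|` Y1)) f) ->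
  (forall f, X2 f -> measurable_wrt (sigma_rv (Z `|` Y2)) f) ->
  indep_sets P (sigma_rv (Y0 `|` Y1 `|` Y2)) (sigma_rv Z) ->
  cond_indep P (sigma_rv (Z `|` X0)) (sigma_rv X1) (sigma_rv X2) <->
  cond_indep P (sigma_rv Y0) (sigma_rv Y1) (sigma_rv Y2).
Proof.
move=> mall YX0 YX1 YX2 XY0 XY1 XY2 ind.
have sig := sigma_algebra_sigma_rv.
have subU (A B : set (T -> R)) (C : set (set T)) : sigma_rv A `<=` C ->
  sigma_rv B `<=` C -> sigma_algebra setT C -> sigma_rv (A `|` B) `<=` C.
  move=> AC BC sC; rewrite sigma_rvU; apply: smallest_sub => //.
  by move=> D [/AC|/BC].
have ZL (A : set (T -> R)) : sigma_rv Z `<=` sigma_rv (Z `|` A) by apply: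
  sigma_rvS => f; left.
have KE : sigma_rv (Z `|` X0) = sigma_rv (Z `|` Y0).
  apply/seteqP; split; apply: subU => //; exact: sigma_rv_sub.
have meas F : F `<=` (Z `|` (X0 `|` X1 `|` X2) `|` (Y0 `|` Y1 `|` Y2)) ->
    sigma_rv F `<=` dT.-measurable.
  by move=> FF; apply: sigma_rv_measurable => f /FF; exact: mall.
have mK : sigma_rv (Z `|` Y0) `<=` dT.-measurable.
  by apply: meas => f [|] ?; [left; left|right; left; left].
have join (A B : set (T -> R)) : sigma_rv B `<=` sigma_rv (Z `|` A) ->
    sigma_rv B `<=` <<s sigma_rv (Z `|` Y0) `|` sigma_rv A >>.
  move=> BA; apply: subset_trans BA _; apply: subU.
  - by apply: subset_trans (ZL Y0) _;
      apply: subset_trans (@sub_sigma_algebra _ _ _) => C; left.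
  - by apply: subset_trans (@sub_sigma_algebra _ _ _) => C; right.
  - exact: smallest_sigma_algebra.
have mX1 : sigma_rv X1 `<=` dT.-measurable by apply: meas => f ?; left; right;
  left; right.
have mX2 : sigma_rv X2 `<=` dT.-measurable by apply: meas => f ?; left; right;
  right.
have mY : sigma_rv (Y0 `|` Y1 `|` Y2) `<=` dT.-measurable by apply: meas =>
  f ?; right.
have Y0Y : sigma_rv Y0 `<=` sigma_rv (Y0 `|` Y1 `|` Y2) by apply: sigma_rvS =>
  f ?; left; left.
have Y1Y : sigma_rv Y1 `<=` sigma_rv (Y0 `|` Y1 `|` Y2) by apply: sigma_rvS =>
  f ?; left; right.
have Y2Y : sigma_rv Y2 `<=` sigma_rv (Y0 `|` Y1 `|` Y2) by apply: sigma_rvS =>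
  f ?; right.
have mY1 := subset_trans Y1Y mY; have mY2 := subset_trans Y2Y mY.
have mZ : sigma_rv Z `<=` dT.-measurable by apply: meas => f ?; left; left.
(* Past and future are exchanged while the conditioning stays on [Z] and [Y0]; [Z] is dropped from
   the conditioning afterwards, which is where independence enters. *)
rewrite KE; apply: (@iff_trans _
  (cond_indep P (sigma_rv (Z `|` Y0)) (sigma_rv Y1) (sigma_rv Y2))).
  by split; apply: cond_indep_subjoin => //; apply: join; exact: sigma_rv_sub.
have up A g : sigma_rv (Y0 `|` Y1 `|` Y2) A -> is_cond_prob P (sigma_rv Y0) A g ->
    is_cond_prob P (sigma_rv (Z `|` Y0)) A g.
  move=> YA cA; rewrite setUC sigma_rvU.
  apply: (is_cond_prob_indep (H := sigma_rv (Y0 `|` Y1 `|` Y2))) => //.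
  by move=> B C; apply: sigma_algebraI.
have YI : setI_closed (sigma_rv (Y0 `|` Y1 `|` Y2)).
  by move=> B C; apply: sigma_algebraI.
have Y0K : sigma_rv Y0 `<=` sigma_rv (Z `|` Y0) by apply: sigma_rvS => f; right.
by split; apply: (cond_indep_change (K := sigma_rv (Z `|` Y0))
  (H := sigma_rv (Y0 `|` Y1 `|` Y2))).
Qed.

End SigmaRV.

(** * Markov sequences under translation and under almost sure equality *)

Section MarkovSequences.
Context {dT : measure_display} {T : measurableType dT} {R : realType}.
Variable P : probability T R.
Variables n d : nat.
Implicit Types x y : 'I_n -> 'I_d -> {RV P >-> R}.

Definition all_coords x : set (T -> R) := \bigcup_k coords (x k).

(** The translation acts on each term separately, so it respects the splitting into present, past
    and future; at every [k] the claim is [cond_indep_translate] for these three families. *)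
Lemma markov_given_translate x y (z : 'I_d -> {RV P >-> R})
    (Gamma : 'I_n -> 'M[R]_d) :
  (forall k i w, y k i w = x k i w - \sum_j Gamma k i j * z j w) ->
  indep_sets P (sigma_rv (all_coords y)) (sigma_rv (coords z)) ->
  markov_given (coords z) x <-> markov_seq y.
Proof.
move=> yE ind.
have mz (Y : set (T -> R)) (u : 'I_d -> R) :
    measurable_fun [set: g_sigma_algebraType (sigma_rv (coords z `|` Y))]
      (fun w => \sum_j u j * z j w).
  apply: measurable_sum => j; apply: measurable_funM => //.
  apply/measurable_wrtP; first exact: sigma_algebra_sigma_rv.
  by apply: measurable_wrt_sigma_rv; left; exists j.
have YX k (Xs : set (T -> R)) i : Xs (x k i) ->
  measurable_wrt (sigma_rv (coords z `|` Xs)) (y k i).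
  move=> Xx; apply/measurable_wrtP; first exact: sigma_algebra_sigma_rv.
  rewrite (_ : (y k i : T -> R) = fun w =>
    x k i w - \sum_j Gamma k i j * z j w); last exact/funext.
  apply: measurable_funB; last exact: mz.
  apply/measurable_wrtP; first exact: sigma_algebra_sigma_rv.
  by apply: measurable_wrt_sigma_rv; right.
have XY k (Ys : set (T -> R)) i : Ys (y k i) ->
  measurable_wrt (sigma_rv (coords z `|` Ys)) (x k i).
  move=> Yy; apply/measurable_wrtP; first exact: sigma_algebra_sigma_rv.
  rewrite (_ : (x k i : T -> R) = fun w =>
    y k i w + \sum_j Gamma k i j * z j w); last first.
    by apply/funext => w; rewrite yE subrK.
  apply: measurable_funD; last exact: mz.
  apply/measurable_wrtP; first exact: sigma_algebra_sigma_rv.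
  by apply: measurable_wrt_sigma_rv; right.
suff H k : cond_indep P (sigma_rv (coords z `|` coords (x k)))
      (sigma_rv (before x k)) (sigma_rv (after x k)) <->
    cond_indep P (sigma_rv (coords (y k)))
      (sigma_rv (before y k)) (sigma_rv (after y k)).
  by split=> M k; [rewrite set0U; exact/H/M|apply/H; have := M k; rewrite set0U].
apply: cond_indep_translate.
- move=> f [[[j _ <-]//|[[[j _ <-]//|[k' _ [j _ <-]]//]|[k' _ [j _
    <-]]//]]|[[[j _ <-]//|[k' _ [j _ <-]]//]|[k' _ [j _ <-]]//]].
- by move=> _ [i _ <-]; apply: YX; exists i.
- by move=> _ [k' kk' [i _ <-]]; apply: YX; exists k' => //; exists i.
- by move=> _ [k' kk' [i _ <-]]; apply: YX; exists k' => //; exists i.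
- by move=> _ [i _ <-]; apply: XY; exists i.
- by move=> _ [k' kk' [i _ <-]]; apply: XY; exists k' => //; exists i.
- by move=> _ [k' kk' [i _ <-]]; apply: XY; exists k' => //; exists i.
- move=> A B YA ZB; apply: ind => //; apply: sigma_rvS YA.
  by move=> f [[[i _ <-]|[k' _ [i _ <-]]]|[k' _ [i _ <-]]]; [exists k => //;
    exists i|exists k' => //; exists i|exists k' => //; exists i].
Qed.

(** A representation valid almost surely determines y only up to null sets; this carries the Markov
    property from one choice to another. *)
Lemma markov_seq_ae x y : (forall k i, ae_eq P setT (x k i) (y k i)) ->
  markov_seq x -> markov_seq y.
Proof.
move=> xy M k.
have yx k' i : ae_eq P setT (y k' i) (x k' i) by exact: ae_eq_sym.
have ctr (u : 'I_d -> {RV P >-> R}) f : coords u f -> measurable_fun [set: T] f.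
  by move=> [i _ <-].
have := M k; rewrite !set0U; apply: cond_indep_ae.
- exact: sigma_algebra_sigma_rv.
- by apply: sigma_rv_measurable => f; exact: ctr.
- by apply: sigma_rv_measurable => f; exact: ctr.
- by apply: sigma_rv_measurable => f [k' _]; exact: ctr.
- by apply: sigma_rv_measurable => f [k' _]; exact: ctr.
- apply: sigma_rv_ae => f; first exact: ctr.
  by move=> [i _ <-]; exists (y k i) => //; exists i.
- apply: sigma_rv_ae => f; first exact: ctr.
  by move=> [i _ <-]; exists (x k i) => //; exists i.
- apply: sigma_rv_ae => f; first by move=> [k' _]; exact: ctr.
  by move=> [k' kk' [i _ <-]]; exists (x k' i) => //; exists k' => //; exists i.
- apply: sigma_rv_ae => f; first by move=> [k' _]; exact: ctr.
  by move=> [k' kk' [i _ <-]]; exists (x k' i) => //; exists k' => //; exists i.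
Qed.

End MarkovSequences.

(** * Independence from trigonometric polynomials *)

Section NewtonSchulz.
Context {R : realType}.
Implicit Types s : R.

(* Odd polynomials that converge boundedly to the sign function on [-1, 1]. *)
Fixpoint newton_schulz n s : R :=
  if n is m.+1 then
    let u := newton_schulz m s in (3 * u - u * u * u) / 2
  else s.

Lemma newton_schulzN n s : newton_schulz n (- s) = - newton_schulz n s.
Proof. by elim: n => //= n ->; ring. Qed.

(** If [u] is an iterate, one minus the next iterate is (1 - u)^2 (2 + u) / 2. This is nonnegative,
    and the factor (1 - u)(2 + u) / 2 is at most 1 - s / 2 because u >= s, whence the geometric
    rate. *)
Lemma newton_schulz_bounds n s : 0 <= s <= 1 ->
  [/\ s <= newton_schulz n s, newton_schulz n s <= 1 &
      1 - newton_schulz n s <= (1 - s / 2) ^+ n].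
Proof.
move=> /andP[s0 s1]; elim: n => [|n [su u1 ub]] /=.
  by rewrite expr0; split => //; lra.
set u := newton_schulz n s in su u1 ub *.
have u0 : 0 <= u by exact: le_trans su.
have uu : u * u <= 1 by nra.
split.
- by apply: le_trans su _; nra.
- rewrite -subr_ge0 (_ : _ - _ = (1 - u) ^+ 2 * (2 + u) / 2); last by field.
  by rewrite divr_ge0// mulr_ge0 ?sqr_ge0//; lra.
- rewrite exprS (_ : _ - _ = ((1 - u) * (2 + u) / 2) * (1 - u)); last by field.
  apply: ler_pM => //; [|by lra|by nra].
  by rewrite divr_ge0// mulr_ge0; lra.
Qed.

Lemma newton_schulz_le1 n s : `|s| <= 1 -> `|newton_schulz n s| <= 1.
Proof.
wlog s0 : s / 0 <= s.
  move=> H s1; have [s0|s0] := leP 0 s; first exact: H.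
  by rewrite -normrN -newton_schulzN H ?normrN// oppr_ge0 ltW.
rewrite ger0_norm// => s1.
have [|su u1 _] := @newton_schulz_bounds n s; first by rewrite s0.
by rewrite ger0_norm// (le_trans s0).
Qed.

Lemma newton_schulz_cvg s : `|s| <= 1 ->
  newton_schulz n s @[n --> \oo] --> Num.sg s.
Proof.
have pos t : 0 < t <= 1 -> newton_schulz n t @[n --> \oo] --> (1 : R).
  move=> /andP[t0 t1].
  have h n : [/\ t <= newton_schulz n t, newton_schulz n t <= 1 &
      1 - newton_schulz n t <= (1 - t / 2) ^+ n].
    by apply: newton_schulz_bounds; rewrite ltW.
  apply: (@squeeze_cvgr _ _ _ _ (fun n => 1 - (1 - t / 2) ^+ n) (cst 1)).
  - by near=> n; have [_ -> ?] := h n; rewrite andbT; lra.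
  - rewrite -[X in _ --> X]subr0; apply: cvgB; first exact: cvg_cst.
    by apply: cvg_expr; rewrite ger0_norm; lra.
  - exact: cvg_cst.
move=> s1; have [s0|s0|->] := ltgtP s 0.
- rewrite ltr0_sg// (_ : (fun n => _) = (fun n => - newton_schulz n (- s)));
    last first.
    by apply/funext => n; rewrite newton_schulzN opprK.
  apply: cvgN; apply: pos; rewrite oppr_gt0 s0/=.
  by rewrite ltr0_norm in s1.
- by rewrite gtr0_sg//; apply: pos; rewrite s0/= -(gtr0_norm s0).
- rewrite sgr0 (_ : (fun n => _) = cst 0); first exact: cvg_cst.
  by apply/funext; elim => //= n ->; ring.
Unshelve. all: by end_near. Qed.

End NewtonSchulz.

(** * Bounded limits of trigonometric polynomials *)

Section TrigonometricClosure.
Context {dT : measure_display} {T : measurableType dT} {R : realType}.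
Variable P : probability T R.
Implicit Types (L : set (T -> R)) (f g : T -> R).

(** Inductive because limits have to be iterated and properties of the class are proved along its
    generation. The phase [b] brings in the sines, which distinguish f from -f; the bound in
    [trig_lim] is uniform for the sake of dominated convergence. *)
Inductive trig_closure L : (T -> R) -> Prop :=
| trig_cos f b : L f -> trig_closure L (fun w => cos (f w + b))
| trig_add f g : trig_closure L f -> trig_closure L g ->
    trig_closure L (fun w => f w + g w)
| trig_scale a f : trig_closure L f -> trig_closure L (fun w => a * f w)
| trig_lim (f_ : nat -> T -> R) f (M : R) : (forall n, trig_closure L (f_ n)) ->
    (forall n w, `|f_ n w| <= M) -> (forall w, f_ n w @[n --> \oo] --> f w) ->
    trig_closure L f.

Lemma trig_closure_bounded L f : (forall g, L g -> measurable_fun [set: T] g) ->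
  trig_closure L f ->
  measurable_fun [set: T] f /\ exists M, forall w, `|f w| <= M.
Proof.
move=> Lm; elim => {f}.
- move=> f b Lf; split; last by exists 1 => w; exact: cos_max.
  apply: (measurableT_comp (f := cos)).
    by apply: continuous_measurable_fun; exact: continuous_cos.
  by apply: measurable_funD => //; exact: Lm.
- move=> f g _ [mf [M fM]] _ [mg [N gN]]; split; first exact: measurable_funD.
  by exists (M + N) => w; rewrite (le_trans (ler_normD _ _))// lerD.
- move=> a f _ [mf [M fM]]; split; first exact: measurable_funM.
  by exists (`|a| * M) => w; rewrite normrM ler_wpM2l.
- move=> f_ f M _ mf_ fM f_f; split; last first.
    exists M => w; apply: (cvgr_to_le (cvg_norm (f_f w))).
    by apply: nearW => n; exact: fM.
  by apply: (measurable_fun_cvg (h := f_)) => // n; have [] := mf_ n.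
Qed.

Lemma trig_closure_ext L f g : f =1 g -> trig_closure L f -> trig_closure L g.
Proof. by move=> /funext ->. Qed.

Section LinearSpace.
Variable L : set (T -> R).
Hypothesis L0 : L (cst 0).
Hypothesis LD : forall f g, L f -> L g -> L (fun w => f w + g w).
Hypothesis LZ : forall a f, L f -> L (fun w => a * f w).
Hypothesis Lm : forall f, L f -> measurable_fun [set: T] f.

Lemma trig_closure_cst a : trig_closure L (cst a).
Proof.
apply: (trig_closure_ext _ (trig_scale a (trig_cos 0 L0))) => w /=.
by rewrite addr0 cos0 mulr1.
Qed.

(** Induction on both factors. For two generators the product-to-sum formula stays in the class, as
    [L] contains sums and differences; in the limit cases the boundedness of the other factor keeps
    the bound uniform. *)
Lemma trig_closureM f g : trig_closure L f -> trig_closure L g ->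
  trig_closure L (fun w => f w * g w).
Proof.
move=> cf; elim: cf g => {f} [f b Lf g|f1 f2 _ IH1 _ IH2 g cg|a f _ IH g cg|
  f_ f M cf_ IH fM f_f g cg].
- elim=> {g} [g b' Lg|g1 g2 _ IH1 _ IH2|a g _ IH|g_ g M cg_ IH gM g_g].
  + have LfN : L (fun w => f w + (-1) * g w) by apply: LD => //; exact: LZ.
    apply: (trig_closure_ext _ (trig_add (trig_scale 2^-1 (trig_cos (b + b')
      (LD Lf Lg)))
      (trig_scale 2^-1 (trig_cos (b - b') LfN)))) => w /=.
    rewrite (_ : f w + g w + (b + b') = (f w + b) + (g w + b')); last by ring.
    rewrite (_ : f w + -1 * g w + (b - b') = (f w + b) - (g w + b')); last by ring.
    by rewrite cosD cosB; field.
  + by apply: trig_closure_ext (trig_add IH1 IH2) => w /=; ring.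
  + by apply: trig_closure_ext (trig_scale a IH) => w /=; ring.
  + apply: (trig_lim (M := M) IH) => [n w|w].
      by rewrite normrM -[M]mul1r ler_pM// cos_max.
    by apply: cvgM; [exact: cvg_cst|exact: g_g].
- by apply: trig_closure_ext (trig_add (IH1 _ cg) (IH2 _ cg)) => w /=; ring.
- by apply: trig_closure_ext (trig_scale a (IH _ cg)) => w /=; ring.
- have [_ [N gN]] := trig_closure_bounded Lm cg.
  apply: (trig_lim (M := M * N) (fun n => IH n _ cg)) => [n w|w].
    by rewrite normrM ler_pM.
  by apply: cvgM; [exact: f_f|exact: cvg_cst].
Qed.

Lemma trig_closure_sg f : trig_closure L f ->
  trig_closure L (fun w => Num.sg (f w)).
Proof.
move=> cf; have [_ [M fM]] := trig_closure_bounded Lm cf.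
(* The absolute value and the 1 make the scaling factor positive whatever [M] is. *)
pose N := `|M| + 1.
have N0 : 0 < N by rewrite ltr_wpDl.
have fN w : `|N^-1 * f w| <= 1.
  rewrite normrM [`|N^-1|]gtr0_norm ?invr_gt0// ler_pdivrMl// mulr1.
  by rewrite (le_trans (fM w))// (le_trans (ler_norm _))// lerDl.
apply: (trig_lim (f_ := fun n w => newton_schulz n (N^-1 * f w)) (M := 1)).
- elim => [|n IH] /=; first exact: trig_scale.
  set u := fun w => newton_schulz n (N^-1 * f w) in IH.
  apply: trig_closure_ext (trig_scale 2^-1 (trig_add (trig_scale 3 IH)
    (trig_scale (-1) (trig_closureM (trig_closureM IH IH) IH)))) => w /=.
  by rewrite /u; field.
- by move=> n w; exact: newton_schulz_le1.
- move=> w; have -> : Num.sg (f w) = Num.sg (N^-1 * f w).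
    by rewrite sgrM [Num.sg N^-1]gtr0_sg ?invr_gt0// mul1r.
  exact: newton_schulz_cvg.
Qed.

Definition trig_closure_sets : set (set T) := [set A | trig_closure L \1_A].

Lemma trig_closure_sets_gt0 f : trig_closure L f ->
  trig_closure_sets [set w | 0 < f w].
Proof.
move=> /trig_closure_sg cf; rewrite /trig_closure_sets/=.
(* The indicator of the positive reals is (sg + sg^2) / 2. *)
apply: trig_closure_ext (trig_scale 2^-1 (trig_add cf (trig_closureM cf cf))) => w.
rewrite indicE; have [f0|f0|f0] := ltgtP (f w) 0.
- by rewrite ltr0_sg// memNset/=; [field|rewrite lt_gtF].
- by rewrite gtr0_sg// mem_set//=; field.
- by rewrite f0 sgr0 memNset/=; [ring|rewrite f0 ltxx].
Qed.

Lemma sigma_algebra_trig_closure_sets : sigma_algebra setT trig_closure_sets.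
Proof.
have C A : trig_closure_sets A -> trig_closure_sets (~` A).
  move=> cA; apply: trig_closure_ext (trig_add (trig_closure_cst 1) (trig_scale
    (-1) cA)).
  by move=> w; rewrite !indicE in_setC; case: (w \in A) => /=; ring.
have U A B : trig_closure_sets A -> trig_closure_sets B ->
  trig_closure_sets (A `|` B).
  move=> cA cB; apply: trig_closure_ext (trig_add cA (trig_add cB
    (trig_scale (-1) (trig_closureM cA cB)))) => w.
  by rewrite !indicE in_setU; case: (w \in A); case: (w \in B) => /=; ring.
have E : trig_closure_sets set0.
  by apply: trig_closure_ext (trig_closure_cst 0) => w; rewrite indicE in_set0.
split => //; first by move=> A /C; rewrite setTD.
move=> A cA.
apply: (trig_lim (f_ := fun n => \1_(\big[setU/set0]_(i < n) A i)) (M := 1)).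
- by elim => [|n IH]; rewrite ?big_ord0// big_ord_recr; exact: U.
- by move=> n w; rewrite indicE; case: (w \in _); rewrite ?normr1 ?normr0.
- move=> w; rewrite indicE; case: (boolP (w \in \bigcup_k A k)) => [|nA].
    rewrite inE => -[k _ Ak]; apply: cvg_near_cst; exists k.+1 => // n /= kn.
    by rewrite indicE mem_set// -bigcup_mkord; exists k.
  apply: cvg_near_cst; apply: nearW => n; rewrite indicE memNset//.
  rewrite -bigcup_mkord => -[k _ Ak]; move: nA; rewrite notin_setE; apply.
  by exists k.
Qed.

(** The function f itself may be unbounded, but {f > s} is the pointwise limit of the sets {sin ((f
    - s) / (n + 1)) > 0}: for large n the argument lies between -pi and pi, where the sine has the
    sign of its argument. The sine is a generator with phase shifted by pi / 2. *)
Lemma sigma_rv_trig_closure : sigma_rv L `<=` trig_closure_sets.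
Proof.
have sS := sigma_algebra_trig_closure_sets.
apply: sigma_rv_sub => // f Lf; apply/measurable_wrtP => //.
apply: (measurability (@RGenOInfty.G R)); first exact: RGenOInfty.measurableE.
move=> _ [_ [s ->] <-]; rewrite setTI /measurable/= (sigma_algebra_id sS).
rewrite (_ : _ @^-1` _ = [set w | 0 < f w - s]); last first.
  by apply/seteqP; split => w /=; rewrite in_itv/= andbT subr_gt0.
pose g n w := sin (n.+1%:R^-1 * (f w - s)).
have cg n : trig_closure L (g n).
  apply: trig_closure_ext (trig_cos (- (n.+1%:R^-1 * s) - pi / 2) (LZ
    n.+1%:R^-1 Lf)) => w.
  by rewrite /g addrA cosBpihalf mulrBr.
apply: (trig_lim (f_ := fun n => \1_[set w | 0 < g n w]) (M := 1)).
- by move=> n; exact: trig_closure_sets_gt0.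
- by move=> n w; rewrite indicE; case: (w \in _); rewrite ?normr1 ?normr0.
- move=> w; apply: cvg_near_cst.
  have lim0 : n.+1%:R^-1 * (f w - s) @[n --> \oo] --> (0 : R).
    rewrite -[X in _ --> X](mul0r (f w - s)); apply: cvgM; last exact: cvg_cst.
    exact: cvg_harmonic.
  move: lim0 => /cvgr0_norm_lt /(_ _ (pi_gt0 R)); apply: filterS => n small.
  rewrite !indicE; congr (nat_of_bool _)%:R; apply/idP/idP; rewrite !inE/= /g.
    apply: contraTT; rewrite -!leNgt subr_le0 => fs.
    rewrite -oppr_ge0 -sinN; apply: sin_ge0_pi;
      rewrite -mulrN mulr_ge0 ?oppr_ge0 ?subr_le0//=.
    by rewrite mulrN ltW// (le_lt_trans (ler_norm _))// normrN.
  by move=> fs; apply: sin_gt0_pi; rewrite mulr_gt0//= ltr_normlW.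
Qed.
End LinearSpace.

Local Notation E f := (\int[P]_w f w).

Lemma bounded_integrable f (M : R) : measurable_fun [set: T] f ->
  (forall w, `|f w| <= M) -> P.-integrable setT (EFin \o f).
Proof.
move=> mf fM; apply: measurable_bounded_integrable => //.
  exact: fin_num_fun_lty.
exists M; split; first by rewrite num_real.
by move=> N MN w _ /=; rewrite (le_trans (fM w))// ltW.
Qed.

Lemma cvg_Rintegral_bounded (f_ : nat -> T -> R) f (M : R) :
  (forall n, measurable_fun [set: T] (f_ n)) ->
  (forall n w, `|f_ n w| <= M) -> (forall w, f_ n w @[n --> \oo] --> f w) ->
  E (f_ n) @[n --> \oo] --> E f.
Proof.
move=> mf fM ff; have mf' : measurable_fun [set: T] f.
  by apply: (measurable_fun_cvg (h := f_)) => // w _; exact: ff.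
have fM' w : `|f w| <= M.
  by apply: (cvgr_to_le (cvg_norm (ff w))); apply: nearW => n; exact: fM.
apply: fine_cvg; rewrite fineK; last first.
  by apply: integrable_fin_num => //; exact: bounded_integrable fM'.
apply: (@dominated_cvg _ _ _ P _ measurableT _ _ (cst M%:E)) => //.
- by move=> n; exact/measurable_EFinP.
- by move=> w _; apply: cvg_EFin; [exact: nearW|exact: ff].
- exact: finite_measure_integrable_cst.
- by move=> n w _; rewrite lee_fin.
Qed.

(** * From the cosine identity to independence of the generated sigma-algebras *)

Section Independence.
Variables L1 L2 : set (T -> R).
Hypothesis m1 : forall f, L1 f -> measurable_fun [set: T] f.
Hypothesis m2 : forall f, L2 f -> measurable_fun [set: T] f.
Hypothesis L0 : L1 (cst 0) /\ L2 (cst 0).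
Hypothesis LD : forall f g, (L1 f -> L1 g -> L1 (fun w => f w + g w)) /\
  (L2 f -> L2 g -> L2 (fun w => f w + g w)).
Hypothesis LZ : forall a f, (L1 f -> L1 (fun w => a * f w)) /\
  (L2 f -> L2 (fun w => a * f w)).
Hypothesis cosE : forall f g b, L1 f -> L2 g ->
  E (fun w => cos (f w + g w + b)) =
  cos b * (E (fun w => cos (f w)) * E (fun w => cos (g w))).

(** Induction on both factors reduces to two generators. There the product-to-sum formula and [cosE]
    give the half-sum of cos (b + b') and cos (b - b'), that is cos b cos b', times E cos f E cos g;
    [cosE] with one function zero identifies this with the product of the means. *)
Lemma trig_closure_expectationM f g : trig_closure L1 f -> trig_closure L2 g ->
  E (fun w => f w * g w) = E f * E g.
Proof.
have int1 h : trig_closure L1 h -> P.-integrable setT (EFin \o h).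
  move=> /(trig_closure_bounded m1)[mh [M hM]]; exact: bounded_integrable hM.
have int2 h : trig_closure L2 h -> P.-integrable setT (EFin \o h).
  move=> /(trig_closure_bounded m2)[mh [M hM]]; exact: bounded_integrable hM.
have int12 h k : trig_closure L1 h -> trig_closure L2 k ->
    P.-integrable setT (EFin \o (fun w => h w * k w)).
  move=> /(trig_closure_bounded m1)[mh [M hM]] /(trig_closure_bounded m2)[mk [N
    kN]].
  apply: (bounded_integrable (M := M * N)); first exact: measurable_funM.
  by move=> w; rewrite normrM ler_pM.
move=> cf cg; elim: cf => {f} [f b Lf|f1 f2 c1 IH1 c2 IH2|a f cf IH|
  f_ f M cf_ IH fM f_f].
- elim: cg => {g} [g b' Lg|g1 g2 c1 IH1 c2 IH2|a g cg IH|g_ g M cg_ IH gM g_g].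
  + have gN : L2 (fun w => -1 * g w) by exact: (LZ _ _).2.
    have cos_int c h k : L1 h -> L2 k ->
      P.-integrable setT (EFin \o (fun w => cos (h w + k w + c))).
      move=> Lh Lk; apply: (bounded_integrable (M := 1)) => [|w];
        last exact: cos_max.
      apply: (measurableT_comp (f := cos)).
        by apply: continuous_measurable_fun; exact: continuous_cos.
      by apply: measurable_funD => //; apply: measurable_funD;
        [exact: m1|exact: m2].
    have E1 : E (fun=> 1) = 1.
      by rewrite Rintegral_cst// mul1r; exact: (congr1 fine (probability_setT P)).
    have e0 : E (fun w => cos (cst 0 w : R)) = 1.
      by under eq_Rintegral do rewrite /= cos0.
    have -> : E (fun w => cos (f w + b)) = cos b * E (fun w => cos (f w)).
      rewrite -[in RHS](mulr1 (E (fun w => cos (f w)))) -e0 -(cosE _ Lf L0.2).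
      by apply: eq_Rintegral => w _; rewrite addr0.
    have -> : E (fun w => cos (g w + b')) = cos b' * E (fun w => cos (g w)).
      rewrite -[in RHS](mul1r (E (fun w => cos (g w)))) -e0 -(cosE _ L0.1 Lg).
      by apply: eq_Rintegral => w _; rewrite add0r.
    transitivity (2^-1 * (E (fun w => cos (f w + g w + (b + b'))) +
        E (fun w => cos (f w + -1 * g w + (b - b'))))).
      rewrite -RintegralD//; [|exact: cos_int|exact: cos_int].
      rewrite -RintegralZl//; last first.
        by apply: (integrableD measurableT (cos_int _ _ _ _ _) (cos_int _ _ _ _ _)).
      apply: eq_Rintegral => w _.
      rewrite (_ : f w + g w + (b + b') = (f w + b) + (g w + b')); last by ring.
      rewrite (_ : f w + -1 * g w + (b - b') = (f w + b) - (g w + b'));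
        last by ring.
      by rewrite [cos (_ + _ + _)]cosD cosB; field.
    rewrite !cosE//.
    under [E (fun w => cos (-1 * g w))]eq_Rintegral do rewrite mulN1r cosN.
    by rewrite cosD cosB; field.
  + have cf : trig_closure L1 (fun w => cos (f w + b)) by exact: trig_cos.
    under eq_Rintegral do rewrite mulrDr.
    rewrite !RintegralD//; try by [exact: int2|exact: int12].
    by rewrite IH1 IH2 mulrDr.
  + have cf : trig_closure L1 (fun w => cos (f w + b)) by exact: trig_cos.
    under eq_Rintegral do rewrite mulrCA.
    rewrite !RintegralZl//; try by [exact: int2|exact: int12].
    by rewrite IH mulrCA.
  + have mcos : measurable_fun [set: T] (fun w => cos (f w + b)).
      by have [] := trig_closure_bounded m1 (trig_cos b Lf).
    have mg n : measurable_fun [set: T] (g_ n) by have [] :=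
      trig_closure_bounded m2 (cg_ n).
    have lim1 : E (fun w => cos (f w + b) * g_ n w) @[n --> \oo] -->
        E (fun w => cos (f w + b) * g w).
      apply: (cvg_Rintegral_bounded (M := M)).
      * by move=> n; exact: measurable_funM.
      * by move=> n w; rewrite normrM -[M]mul1r ler_pM// cos_max.
      * by move=> w; apply: cvgM; [exact: cvg_cst|exact: g_g].
    have lim2 : E (fun w => cos (f w + b) * g_ n w) @[n --> \oo] -->
        E (fun w => cos (f w + b)) * E g.
      rewrite (_ : (fun n => _) = fun n => E (fun w =>
        cos (f w + b)) * E (g_ n)); last first.
        by apply/funext => n; exact: IH.
      by apply: cvgM; [exact: cvg_cst|exact: (cvg_Rintegral_bounded mg gM g_g)].
    exact: (cvg_unique _ lim1 lim2).
- under eq_Rintegral do rewrite mulrDl.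
  rewrite !RintegralD//; try by [exact: int1|exact: int12].
  by rewrite IH1 IH2 mulrDl.
- under eq_Rintegral do rewrite -mulrA.
  rewrite !RintegralZl//; try by [exact: int1|exact: int12].
  by rewrite IH mulrA.
- have [mg [N gN]] := trig_closure_bounded m2 cg.
  have mf n : measurable_fun [set: T] (f_ n) by have [] := trig_closure_bounded
    m1 (cf_ n).
  have lim1 : E (fun w => f_ n w * g w) @[n --> \oo] --> E (fun w => f w * g w).
    apply: (cvg_Rintegral_bounded (M := M * N)).
    + by move=> n; exact: measurable_funM.
    + by move=> n w; rewrite normrM ler_pM.
    + by move=> w; apply: cvgM; [exact: f_f|exact: cvg_cst].
  have lim2 : E (fun w => f_ n w * g w) @[n --> \oo] --> E f * E g.
    rewrite (_ : (fun n => _) = fun n => E (f_ n) * E g); last first.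
      by apply/funext => n; exact: IH.
    by apply: cvgM; [exact: (cvg_Rintegral_bounded mf fM f_f)|exact: cvg_cst].
  exact: (cvg_unique _ lim1 lim2).
Qed.

Lemma indep_sigma_rv : indep_sets P (sigma_rv L1) (sigma_rv L2).
Proof.
move=> A B sA sB.
have mA : measurable A by apply: (sigma_rv_measurable m1).
have mB : measurable B by apply: (sigma_rv_measurable m2).
have cA : trig_closure_sets L1 A.
  by apply: sigma_rv_trig_closure sA => //; [case: L0|move=> f g; case: (LD f g)|
    move=> a f; case: (LZ a f)].
have cB : trig_closure_sets L2 B.
  by apply: sigma_rv_trig_closure sB => //; [case: L0|move=> f g; case: (LD f g)|
    move=> a f; case: (LZ a f)].
have PE C : measurable C -> P C = (E (\1_C))%:E.
  move=> mC; rewrite fineK; first by rewrite integral_indic// setIT.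
  by apply: integrable_fin_num => //; apply: integrable_indic.
rewrite (PE _ mA) (PE _ mB) PE; last exact: measurableI.
rewrite -EFinM -trig_closure_expectationM//; congr (_%:E).
by apply: eq_Rintegral => w _; rewrite indicI.
Qed.

End Independence.
End TrigonometricClosure.

(** * Normal laws on the line *)

Section NormalLaw.
Context {R : realType}.
Local Notation mu := (@lebesgue_measure R).
Implicit Types (f : R -> \bar R) (a b m s x y : R).

(** The image of Lebesgue measure under x -> a x + b, scaled by a, agrees with Lebesgue measure on
    half-open intervals, hence everywhere. *)
Lemma ge0_integral_affine a b f : 0 < a -> measurable_fun [set: R] f ->
  (forall x, (0 <= f x)%E) ->
  (a%:E * \int[mu]_x f (a * x + b)%R = \int[mu]_x f x)%E.
Proof.
move=> a0 mf f0.
pose phi (x : measurableTypeR R) : measurableTypeR R := a * x + b.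
have mphi : measurable_fun [set: measurableTypeR R] phi.
  by apply: measurable_funD => //; exact: measurable_funM.
pose pf : {measure set (measurableTypeR R) -> \bar R} := pushforward mu phi.
pose nu := mscale (NngNum (ltW a0)) (pf mphi).
transitivity (\int[nu]_x f x)%E.
  rewrite ge0_integral_mscale//; congr (_ * _)%E.
  by rewrite ge0_integral_pushforward.
apply: eq_measure_integral => A mA _; apply/esym/lebesgue_measure_unique => //.
move=> _ [[u v] _ <-].
rewrite [RHS](_ : _ = (a%:E * mu (phi @^-1` `]u, v]%classic))%E)//.
rewrite (_ : phi @^-1` _ = `](u - b) / a, (v - b) / a]%classic); last first.
  apply/seteqP; split => x /=; rewrite /phi !in_itv/=;
  by rewrite ltr_pdivrMr// ler_pdivlMr// ltrBlDr lerBrDr mulrC.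
rewrite !lebesgue_measure_itv/= !lte_fin ltr_pM2r ?invr_gt0// ltrD2r.
case: ifP => _; last by rewrite mule0.
by rewrite -!EFinB -EFinM; congr (_%:E); field; rewrite gt_eqF.
Qed.

Lemma ge0_integral_opp f : measurable_fun [set: R] f ->
  (forall x, (0 <= f x)%E) -> (\int[mu]_x f (- x)%R = \int[mu]_x f x)%E.
Proof.
move=> mf f0.
have mN : measurable_fun [set: measurableTypeR R] (-%R : measurableTypeR R ->
  measurableTypeR R).
  exact: oppr_measurable.
transitivity (\int[pushforward mu (-%R : measurableTypeR R ->
  measurableTypeR R)]_x f x)%E.
  by rewrite ge0_integral_pushforward.
by apply: eq_measure_integral => A mA _; exact: lebesgue_measureN.
Qed.

Lemma ge0_integral_reflect a f : measurable_fun [set: R] f ->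
  (forall x, (0 <= f x)%E) -> (\int[mu]_x f (a - x)%R = \int[mu]_x f x)%E.
Proof.
move=> mf f0; rewrite -(ge0_integral_opp (f := f))//.
rewrite -(@ge0_integral_affine 1 (- a) (fun x => f (- x)%R))//.
- rewrite mul1e; apply: eq_integral => x _; congr f; ring.
- by apply: measurableT_comp.
Qed.

(** The Radon-Nikodym derivative of the normal law and [normal_pdf] have the same integral over
    every measurable set, hence agree almost everywhere. *)
Lemma ge0_integral_normal_prob m s f : measurable_fun [set: R] f ->
  (forall x, (0 <= f x)%E) ->
  (\int[normal_prob m s]_x f x = \int[mu]_x (f x * (normal_pdf m s x)%:E))%E.
Proof.
move=> mf f0; have dom := normal_prob_dominates m s.
rewrite -(Radon_Nikodym_SigmaFinite.change_of_variables dom)//.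
apply: ae_eq_integral => //.
- apply: emeasurable_funM => //.
  exact: measurable_int (Radon_Nikodym_SigmaFinite.f_integrable dom).
- apply: emeasurable_funM => //; apply/measurable_EFinP.
  exact: measurable_normal_pdf.
- apply: ae_eqe_mul2l; apply: integral_ae_eq => //.
  + exact: Radon_Nikodym_SigmaFinite.f_integrable.
  + by apply/measurable_EFinP; exact: measurable_normal_pdf.
  + by move=> E _ mE; rewrite -Radon_Nikodym_SigmaFinite.f_integral.
Qed.

Lemma normal_pdf_gt0E m s x : 0 < s -> normal_pdf m s x =
  (Num.sqrt (s ^+ 2 * pi *+ 2))^-1 * expR (- (x - m) ^+ 2 / (s ^+ 2 *+ 2)).
Proof. by move=> s0; rewrite normal_pdfE// gt_eqF. Qed.

(* Completing the square in the product of two Gaussian densities. *)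
Lemma normal_pdf_mul s1 s2 x y : 0 < s1 -> 0 < s2 ->
  let s := Num.sqrt (s1 ^+ 2 + s2 ^+ 2) in
  normal_pdf 0 s1 (x - y) * normal_pdf 0 s2 y =
  normal_pdf 0 s x * normal_pdf (x * s2 ^+ 2 / s ^+ 2) (s1 * s2 / s) y.
Proof.
move=> s10 s20 s; have ss : s ^+ 2 = s1 ^+ 2 + s2 ^+ 2.
  by rewrite sqr_sqrtr// addr_ge0// sqr_ge0.
have s0 : 0 < s by rewrite sqrtr_gt0 addr_gt0// exprn_gt0.
rewrite !normal_pdf_gt0E//; last by rewrite divr_gt0// mulr_gt0.
rewrite !subr0 mulrACA -expRD [RHS]mulrACA -expRD; congr (_ * expR _).
  rewrite -!invfM -!sqrtrM; last 2 first.
  - by rewrite mulrn_wge0// mulr_ge0 ?pi_ge0// sqr_ge0.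
  - by rewrite mulrn_wge0// mulr_ge0 ?pi_ge0// sqr_ge0.
  by congr (Num.sqrt _)^-1; field; rewrite gt_eqF.
by rewrite !expr_div_n exprMn ss; field; rewrite !gt_eqF// addr_gt0// exprn_gt0.
Qed.

(** Convolution of two centered normal laws, written as an iterated integral. After Tonelli,
    [normal_pdf_mul] leaves a probability density in y, which integrates to 1. *)
Lemma normal_prob_conv s1 s2 f : 0 < s1 -> 0 < s2 ->
  measurable_fun [set: R] f -> (forall x, (0 <= f x)%E) ->
  (\int[mu]_y ((\int[normal_prob 0 s1]_x f (x + y)%R) * (normal_pdf 0 s2 y)%:E) =
   \int[normal_prob 0 (Num.sqrt (s1 ^+ 2 + s2 ^+ 2))]_x f x)%E.
Proof.
move=> s10 s20 mf f0; set s := Num.sqrt _.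
have s0 : 0 < s by rewrite sqrtr_gt0 addr_gt0// exprn_gt0.
have mpdf m t : measurable_fun [set: R] (EFin \o normal_pdf m t).
  by apply/measurable_EFinP; exact: measurable_normal_pdf.
have pdf0 m t x : (0 <= (normal_pdf m t x)%:E)%E by rewrite lee_fin normal_pdf_ge0.
pose h (z : R * R) := (f z.2 * (normal_pdf 0 s1 (z.2 - z.1) * normal_pdf 0 s2
  z.1)%:E)%E.
have mh : measurable_fun [set: R * R] h.
  apply: emeasurable_funM; first by apply: measurableT_comp.
  apply/measurable_EFinP; apply: measurable_funM.
    apply: (measurableT_comp (measurable_normal_pdf _ _)).
    by apply: measurable_funB.
  by apply: (measurableT_comp (measurable_normal_pdf _ _)).
have h0 z : (0 <= h z)%E.
  by rewrite mule_ge0// lee_fin mulr_ge0// normal_pdf_ge0.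
transitivity (\int[mu]_y \int[mu]_x h (y, x))%E.
  apply: eq_integral => y _.
  have mfy : measurable_fun [set: R] (fun x => f (x + y)%R).
    by apply: measurableT_comp => //; exact: measurable_funD.
  rewrite ge0_integral_normal_prob//.
  rewrite -(@ge0_integral_affine 1 (- y) (fun x =>
    f (x + y)%R * (normal_pdf 0 s1 x)%:E)%E)//; last 2 first.
  - by apply: emeasurable_funM => //; exact: mpdf.
  - by move=> x; rewrite mule_ge0.
  rewrite mul1e -ge0_integralZr//; last 2 first.
  - apply: emeasurable_funM.
      by apply: measurableT_comp => //; apply: measurable_funD => //;
        apply: measurable_funD => //; exact: measurable_funM.
    apply: (measurableT_comp (mpdf 0 s1)).
    by apply: measurable_funD => //; exact: measurable_funM.
  - by move=> x _; rewrite mule_ge0.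
  by apply: eq_integral => x _; rewrite /h/= mul1r subrK -muleA -EFinM.
transitivity (\int[mu]_x \int[mu]_y h (y, x))%E.
  exact: (@fubini_tonelli _ _ _ _ _ mu mu h).
rewrite ge0_integral_normal_prob//.
apply: eq_integral => x _.
rewrite /h/=; under eq_integral do rewrite normal_pdf_mul// EFinM muleA.
rewrite ge0_integralZl//.
- by rewrite integral_normal_pdf mule1.
- exact: mpdf.
- by rewrite mule_ge0.
Qed.

Lemma integrable_normal_prob_bounded m s (g : R -> R) M :
  measurable_fun [set: R] g -> (forall x, `|g x| <= M) ->
  (normal_prob m s).-integrable setT (EFin \o g).
Proof. by move=> mg gM; apply: (@bounded_integrable _ _ R (normal_prob m s) g
  M). Qed.

Lemma normal_pdf_reflect m s x : 0 < s ->
  normal_pdf m s (m *+ 2 - x) = normal_pdf m s x.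
Proof.
move=> s0; rewrite (normal_pdf_gt0E m _ s0) (normal_pdf_gt0E m x s0).
by rewrite (_ : m *+ 2 - x - m = - (x - m)) ?sqrrN//; ring.
Qed.

Lemma ge0_integral_normal_reflect m s f : 0 < s -> measurable_fun [set: R] f ->
  (forall x, (0 <= f x)%E) ->
  (\int[normal_prob m s]_x f (m *+ 2 - x)%R = \int[normal_prob m s]_x f x)%E.
Proof.
move=> s0 mf f0.
have mf' : measurable_fun [set: R] (fun x => f (m *+ 2 - x)%R).
  by apply: measurableT_comp => //; exact: measurable_funB.
have mpdf : measurable_fun [set: R] (EFin \o normal_pdf m s).
  by apply/measurable_EFinP; exact: measurable_normal_pdf.
rewrite !ge0_integral_normal_prob//.
have mg : measurable_fun [set: R] (fun x => f x * (normal_pdf m s x)%:E)%E.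
  by apply: emeasurable_funM => //; exact: mpdf.
have g0 x : (0 <= f x * (normal_pdf m s x)%:E)%E.
  by rewrite mule_ge0// lee_fin normal_pdf_ge0.
apply: etrans (ge0_integral_reflect (m *+ 2) mg g0).
apply: eq_integral => x _; congr (_ * _%:E)%E.
by rewrite (normal_pdf_reflect m x s0).
Qed.

Lemma integral_normal_reflect m s f : 0 < s -> measurable_fun [set: R] f ->
  (\int[normal_prob m s]_x f (m *+ 2 - x)%R = \int[normal_prob m s]_x f x)%E.
Proof.
move=> s0 mf.
have Ep := ge0_integral_normal_reflect m s0 (measurable_funepos mf) (funepos_ge0 f).
have En := ge0_integral_normal_reflect m s0 (measurable_funeneg mf) (funeneg_ge0 f).
rewrite [RHS]integralE -Ep -En integralE; congr (_ - _)%E;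
  by apply: eq_integral => x _; rewrite ?funeposE ?funenegE.
Qed.

Let measurable_cosD b : measurable_fun [set: R] (fun x => cos (x + b)).
Proof.
apply: (measurableT_comp (f := cos)); last exact: measurable_funD.
by apply: continuous_measurable_fun; exact: continuous_cos.
Qed.

Let integrable_cosD s b : (normal_prob 0 s).-integrable setT (fun x =>
  (cos (x + b))%:E).
Proof. by apply: (@integrable_normal_prob_bounded 0 s _ 1) => // x;
  exact: cos_max. Qed.

(** For s > 0, the characteristic function at 1 of the centered normal law, real by symmetry. The
    property exploited is its multiplicativity under convolution. *)
Definition normal_cf s := \int[normal_prob 0 s]_x cos x.

(* The sine part vanishes by symmetry. *)
Lemma integral_normal_cosD s b : 0 < s ->
  \int[normal_prob 0 s]_x cos (x + b) = cos b * normal_cf s.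
Proof.
move=> s0.
have sym c : \int[normal_prob 0 s]_x cos (x + c) = \int[normal_prob 0 s]_x cos
  (x - c).
  rewrite /Rintegral; congr fine.
  have mc : measurable_fun [set: R] (fun x =>
    (cos (x + c))%:E) by exact/measurable_EFinP.
  rewrite -(integral_normal_reflect 0 s0 mc); apply: eq_integral => x _;
    congr (_%:E).
  by rewrite mul0rn sub0r -cosN; congr cos; ring.
suff : \int[normal_prob 0 s]_x cos (x + b) + \int[normal_prob 0 s]_x cos (x - b) =
    2 * cos b * normal_cf s.
  by rewrite -sym -mulr2n -[_ *+ 2]mulr_natl -mulrA => /mulfI; apply;
    rewrite pnatr_eq0.
have ic : (normal_prob 0 s).-integrable setT (EFin \o (cos : R -> R)).
  by have := integrable_cosD s 0; under eq_fun do rewrite addr0.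
have ED := RintegralD measurableT (integrable_cosD s b) (integrable_cosD s (- b)).
have EZ := RintegralZl (2 * cos b) measurableT ic.
rewrite /normal_cf -EZ -ED.
by apply: eq_Rintegral => x _; rewrite cosB cosD; ring.
Qed.

Lemma normal_cf_le1 s : `|normal_cf s| <= 1.
Proof.
have i0 : (normal_prob 0 s).-integrable setT (EFin \o (cos : R -> R)).
  by have := integrable_cosD s 0; under eq_fun do rewrite addr0.
apply: le_trans (le_normr_Rintegral _ i0) _ => //.
have <- : \int[normal_prob 0 s]_x (1 : R) = 1.
  by rewrite Rintegral_cst// mul1r;
    exact: (congr1 fine (probability_setT (normal_prob 0 s))).
apply: le_Rintegral => //.
- by apply/integrable_norm.
- exact: finite_measure_integrable_cst.
- by move=> x _; exact: cos_max.
Qed.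

(** Integrating out the two independent summands one after the other produces one factor [normal_cf]
    each time, by [integral_normal_cosD]. *)
Lemma integral_normal_conv_cosD s1 s2 b : 0 < s1 -> 0 < s2 ->
  \int[normal_prob 0 (Num.sqrt (s1 ^+ 2 + s2 ^+ 2))]_x cos (x + b) =
  cos b * (normal_cf s1 * normal_cf s2).
Proof.
move=> s10 s20; set s := Num.sqrt _.
have one t (u : R -> R) : (normal_prob 0 t).-integrable setT (EFin \o u) ->
    (\int[normal_prob 0 t]_x (1 + u x)%:E = (1 + \int[normal_prob 0 t]_x u x)%:E)%E.
  move=> iu; rewrite integralD_EFin//; last exact: finite_measure_integrable_cst.
  rewrite integral_cst// mul1e EFinD fineK; last exact: integrable_fin_num.
  by congr (_ + _)%E; exact: probability_setT.
have cos1 t : (0 <= (1 + cos t : R)%:E)%E.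
  by rewrite lee_fin -lerBlDl sub0r cos_geN1.
(* The convolution formula is for nonnegative functions, so the cosine is raised by 1 and the
   constant cancelled afterwards. *)
have := @normal_prob_conv s1 s2 (fun x => (1 + cos (x + b))%:E) s10 s20.
move=> /(_ _ _)/=.
rewrite one; last exact: integrable_cosD.
move=> H; apply: (addrI 1); apply: EFin_inj; rewrite -H//; last first.
  by apply/measurable_EFinP; exact: measurable_funD.
transitivity (\int[normal_prob 0 s2]_y (1 + normal_cf s1 * cos (y + b))%:E)%E.
  rewrite ge0_integral_normal_prob//; last 2 first.
  - apply/measurable_EFinP; apply: measurable_funD => //; exact: measurable_funM.
  - move=> y; rewrite lee_fin -lerBlDl sub0r lerNl.
    by rewrite (le_trans (ler_norm _))// normrN normrM mulr_ile1//
      ?normal_cf_le1// cos_max.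
  apply: eq_integral => y _; congr (_ * _)%E.
  under eq_integral do rewrite -addrA.
  rewrite one; last exact: integrable_cosD.
  by rewrite integral_normal_cosD// mulrC.
rewrite one; last first.
  apply: (integrableZl _ (normal_cf s1) (integrable_cosD s2 b)) => //.
congr (_ + _)%:E.
apply: etrans (RintegralZl (normal_cf s1) measurableT (integrable_cosD s2 b)) _.
rewrite [RHS]mulrCA; apply: (congr1 (fun r => normal_cf s1 * r)).
exact: integral_normal_cosD.
Qed.

(** * The second moment of centered normal laws *)

Lemma normal_pdf1_ge (x : R) : 1 <= x <= 2 -> normal_pdf 0 1 2 <= normal_pdf 0 1 x.
Proof.
move=> /andP[x1 x2]; rewrite (normal_pdf_gt0E 0 2 ltr01) (normal_pdf_gt0E 0 x
  ltr01).
apply: ler_wpM2l; first by rewrite invr_ge0 sqrtr_ge0.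
rewrite ler_expR; apply: ler_wpM2r; first by rewrite invr_ge0 mulrn_wge0// sqr_ge0.
by rewrite lerN2 !subr0; apply: lerXn2r => //; rewrite nnegrE; lra.
Qed.

(** The variance of the standard normal law, as an extended real. Once it is known to be positive
    and finite, second moments determine [s ^+ 2]. *)
Definition normal_var1 := (\int[normal_prob 0 1%R]_x ((x : R) ^+ 2)%:E)%E.

Let measurable_sqr : measurable_fun [set: R] (fun x : R => (x ^+ 2)%:E).
Proof. by apply/measurable_EFinP; exact: measurable_funX. Qed.

Let mpdf m s : measurable_fun [set: R] (EFin \o normal_pdf m s).
Proof. by apply/measurable_EFinP; exact: measurable_normal_pdf. Qed.

Lemma integral_normal_sqr s : 0 < s ->
  (\int[normal_prob 0 s]_x (x ^+ 2)%:E = (s ^+ 2)%:E * normal_var1)%E.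
Proof.
move=> s0; have sqr_ge x : (0 <= (x ^+ 2 : R)%:E)%E by rewrite lee_fin sqr_ge0.
rewrite /normal_var1 !ge0_integral_normal_prob//.
have mg : measurable_fun [set: R] (fun x => (x ^+ 2)%:E * (normal_pdf 0 s x)%:E)%E.
  by apply: emeasurable_funM => //; exact: mpdf.
have g0 x : (0 <= (x ^+ 2)%:E * (normal_pdf 0 s x)%:E)%E.
  by rewrite mule_ge0// lee_fin normal_pdf_ge0.
have m1 : measurable_fun [set: R] (fun x =>
  (x ^+ 2)%:E * (normal_pdf 0 1%R x)%:E)%E.
  by apply: emeasurable_funM => //; exact: mpdf.
have h0 x : (0 <= (x ^+ 2)%:E * (normal_pdf 0 1%R x)%:E)%E.
  by rewrite mule_ge0// lee_fin normal_pdf_ge0.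
apply: etrans (esym (ge0_integral_affine 0 s0 mg g0)) _.
rewrite expr2 EFinM -muleA; apply: (congr1 (fun r => s%:E * r)%E).
have s0' : (0 <= s%:E)%E by rewrite lee_fin ltW.
apply: etrans _ (ge0_integralZl mu measurableT m1 (fun x _ => h0 x) s0').
apply: eq_integral => x _; rewrite -!EFinM addr0; congr (_%:E).
rewrite (normal_pdf_gt0E 0 _ s0) (normal_pdf_gt0E 0 x ltr01) !subr0.
have -> : Num.sqrt (s ^+ 2 * pi *+ 2) = s * Num.sqrt (1 ^+ 2 * pi *+ 2).
  by rewrite -mulrnAr sqrtrM ?sqr_ge0// sqrtr_sqr gtr0_norm// expr1n mul1r.
have r0 : Num.sqrt (1 ^+ 2 * pi *+ 2) != 0 :> R.
  by rewrite gt_eqF// sqrtr_gt0 pmulrn_lgt0// mulr_gt0 ?pi_gt0// exprn_gt0.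
rewrite (_ : - (s * x) ^+ 2 / (s ^+ 2 *+ 2) = - x ^+ 2 / (1 ^+ 2 *+ 2)); last first.
  by field; rewrite gt_eqF.
by field; rewrite r0 gt_eqF.
Qed.

(** On [1, 2] the integrand is at least the density at 2, which is positive. *)
Lemma normal_var1_gt0 : (0 < normal_var1)%E.
Proof.
have sqr_ge x : (0 <= (x ^+ 2 : R)%:E)%E by rewrite lee_fin sqr_ge0.
rewrite /normal_var1 ge0_integral_normal_prob//.
pose c : R := normal_pdf 0 1 2.
have c0 : 0 < c.
  rewrite /c (normal_pdf_gt0E 0 2 ltr01) mulr_gt0 ?expR_gt0// invr_gt0 sqrtr_gt0.
  by rewrite pmulrn_lgt0// mulr_gt0 ?pi_gt0// exprn_gt0.
apply: (@lt_le_trans _ _ (\int[mu]_(x in `[1%R, 2%R]) c%:E)%E).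
  rewrite integral_cst//= lebesgue_measure_itv/= lte_fin ltr1n -EFinB -EFinM
    lte_fin.
  by rewrite mulr_gt0// subr_gt0 ltr1n.
apply: (@le_trans _ _ (\int[mu]_(x in `[1%R, 2%R]) ((x ^+ 2)%:E * (normal_pdf 0
  1%R x)%:E))%E).
  apply: ge0_le_integral => //.
  - by move=> x _; rewrite lee_fin ltW.
  - apply: measurable_funTS; apply: emeasurable_funM => //; exact: mpdf.
  - move=> x /=; rewrite in_itv/= => x12.
    rewrite -EFinM lee_fin -[c]mul1r; apply: ler_pM => //; first exact: ltW.
      by rewrite -[1](expr1n _ 2) lerXn2r// ?nnegrE; move: x12 => /andP[]; lra.
    exact: normal_pdf1_ge.
apply: ge0_subset_integral => //.
- by apply: emeasurable_funM => //; exact: mpdf.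
- by move=> x _; rewrite mule_ge0// lee_fin normal_pdf_ge0.
Qed.

(** The integrand is dominated by a multiple of the normal density of deviation 2: write exp (- x^2
    / 2) as exp (- 3 x^2 / 8) exp (- x^2 / 8) and use 1 + t <= exp t at t = 3 x^2 / 8. *)
Lemma normal_var1_lty : (normal_var1 < +oo)%E.
Proof.
have sqr_ge x : (0 <= (x ^+ 2 : R)%:E)%E by rewrite lee_fin sqr_ge0.
have two0 : (0 : R) < 2 by [].
rewrite /normal_var1 ge0_integral_normal_prob//.
(* The bound 8 / 3 times the quotient of the two normalizing constants. *)
pose K : R := (Num.sqrt (1 ^+ 2 * pi *+ 2))^-1 * (8 / 3) * Num.sqrt (2 ^+ 2 *
  pi *+ 2).
apply: (@le_lt_trans _ _ (\int[mu]_x (K%:E * (normal_pdf 0 2 x)%:E))%E); last first.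
  rewrite integralZl//; last exact: integrable_normal_pdf.
  by rewrite integral_normal_pdf mule1 ltry.
have r0 : 0 < Num.sqrt (2 ^+ 2 * pi *+ 2) :> R.
  by rewrite sqrtr_gt0 pmulrn_lgt0// mulr_gt0 ?pi_gt0// exprn_gt0.
apply: ge0_le_integral => //.
- by move=> x _; rewrite mule_ge0// lee_fin normal_pdf_ge0.
- by apply: emeasurable_funM => //; exact: mpdf.
- by apply: emeasurable_funM => //; exact: mpdf.
move=> x _; rewrite -!EFinM lee_fin (normal_pdf_gt0E 0 x ltr01)
  (normal_pdf_gt0E 0 x two0).
rewrite !subr0 /K.
have {K} key : x ^+ 2 * expR (- x ^+ 2 / (1 ^+ 2 *+ 2)) <=
    8 / 3 * expR (- x ^+ 2 / (2 ^+ 2 *+ 2)).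
  rewrite (_ : - x ^+ 2 / (1 ^+ 2 *+ 2) =
    - (3 / 8 * x ^+ 2) + - x ^+ 2 / (2 ^+ 2 *+ 2)); last by field.
  rewrite expRD mulrA ler_wpM2r ?expR_ge0// expRN.
  rewrite ler_pdivrMr ?expR_gt0//.
  by have := expR_ge1Dx (3 / 8 * x ^+ 2); lra.
set r1 := Num.sqrt (1 ^+ 2 * _ *+ 2); set r2 := Num.sqrt _ in r0 *.
rewrite -[leRHS]mulrA mulVKf ?gt_eqF// mulrCA -[leRHS]mulrA.
by apply: ler_wpM2l key; rewrite invr_ge0 sqrtr_ge0.
Qed.

End NormalLaw.

(** * Gaussian families *)

Section CenteredGaussian.
Context {dT : measure_display} {T : measurableType dT} {R : realType}.
Variable P : probability T R.
Implicit Types (f g : T -> R).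

Lemma integral_law f (nu : {measure set (measurableTypeR R) -> \bar R})
    (h : R -> \bar R) :
  measurable_fun [set: T] f ->
  (forall A, measurable A -> P (f @^-1` A) = nu A) ->
  measurable_fun [set: R] h ->
  (\int[P]_w h (f w) = \int[nu]_x h x)%E.
Proof.
move=> mf law mh.
have ge0 (k : R -> \bar R) : measurable_fun [set: R] k ->
  (forall x, (0 <= k x)%E) ->
    (\int[P]_w k (f w) = \int[nu]_x k x)%E.
  move=> mk k0.
  transitivity (\int[pushforward P (f : T -> measurableTypeR R)]_x k x)%E.
    by rewrite ge0_integral_pushforward.
  by apply: eq_measure_integral => A mA _; exact: law.
rewrite [RHS]integralE -(ge0 _ (measurable_funepos mh) (funepos_ge0 h)).
rewrite -(ge0 _ (measurable_funeneg mh) (funeneg_ge0 h)) integralE.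
by congr (_ - _)%E; apply: eq_integral => x _; rewrite ?funeposE ?funenegE.
Qed.

Lemma integral_cstP (r : R) : (\int[P]_w r%:E = r%:E)%E.
Proof. by have := expectation_cst P r; rewrite unlock. Qed.

Definition centered_normal f := [/\ measurable_fun [set: T] f, is_normal P f &
  (\int[P]_w (f w)%:E = 0)%E].

(** The case [s = 0] stands for the Dirac mass at 0, so that one parameter covers degenerate
    variables too and the second moment is always [s ^+ 2] times [normal_var1]. *)
Definition has_normal_law f (s : R) :=
  (s = 0 /\ {ae P, forall w, f w = 0}) \/
  (0 < s /\ forall A, measurable A -> P (f @^-1` A) = normal_prob 0 s A).

Let measurable_EFinT : measurable_fun [set: R] (EFin : R -> \bar R).
Proof. exact/measurable_EFinP. Qed.

(** In the nondegenerate case the location is found by symmetry: f and 2m - f have the same law, so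
    both have mean 0 and 2m = 0. *)
Lemma centered_normalP f : centered_normal f -> exists s, has_normal_law f s.
Proof.
move=> [mf [[m law]|[m [s [s0 law]]]] mean0].
  have mN : measurable (~` (f @^-1` [set m])).
    by apply: measurableC; rewrite -[_ @^-1` _]setTI; exact: mf.
  have fm : {ae P, forall w, f w = m}.
    exists (~` (f @^-1` [set m])); split => //.
    rewrite probability_setC; last by rewrite -[_ @^-1` _]setTI; exact: mf.
    by rewrite law// diracE mem_set// subee.
  have m0 : m = 0.
    move: mean0; rewrite (ae_eq_integral (cst m%:E))//.
    - by rewrite integral_cstP => -[].
    - exact/measurable_EFinP.
    - by apply: filterS fm => w -> _.
  by exists 0; left; rewrite -[in X in {ae P, forall w, _ = X}]m0.
suff m0 : m = 0 by exists s; right; rewrite m0 in law.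
have E1 := integral_law mf (nu := normal_prob m s) law measurable_EFinT.
(* Integrability is read off the mean: a finite difference of the integrals of the positive and
   negative parts has finite terms. *)
have fi : P.-integrable setT (EFin \o f).
  apply/integrableP; split; first exact/measurable_EFinP.
  have : (\int[P]_w (f w)%:E)%E \is a fin_num by rewrite mean0.
  rewrite integralE fin_numB => /andP[pfin nfin].
  rewrite (_ : (fun w => `|(EFin \o f) w|%E) = (EFin \o f)^\+ \+ (EFin \o
    f)^\-)%E; last first.
    by rewrite -fune_abse.
  rewrite ge0_integralD//; last 2 first.
  - exact/measurable_funTS/measurable_funepos/measurable_EFinP.
  - exact/measurable_funTS/measurable_funeneg/measurable_EFinP.
  by rewrite lte_add_pinfty// ltey_eq ?pfin ?nfin.
have E2 : (\int[P]_w (m *+ 2 - f w)%:E = 0)%E.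
  have mr : measurable_fun [set: R] (fun x : R => (m *+ 2 - x)%:E).
    by apply/measurable_EFinP; exact: measurable_funB.
  rewrite (integral_law mf (nu := normal_prob m s) law mr).
  by rewrite (integral_normal_reflect m s0 measurable_EFinT) -E1.
move: E2; rewrite integralB_EFin//; last exact: finite_measure_integrable_cst.
by rewrite mean0 sube0 integral_cstP => -[] /eqP; rewrite mulrn_eq0/= => /eqP.
Qed.

Let measurable_cosD b : measurable_fun [set: R] (fun x : R => (cos (x + b))%:E).
Proof.
apply/measurable_EFinP; apply: (measurableT_comp (f := cos));
  last exact: measurable_funD.
by apply: continuous_measurable_fun; exact: continuous_cos.
Qed.

Lemma normal_law_sqr f s : measurable_fun [set: T] f -> has_normal_law f s ->
  (\int[P]_w (f w ^+ 2)%:E = (s ^+ 2)%:E * normal_var1 (R := R))%E.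
Proof.
move=> mf [[-> f0]|[s0 law]].
  rewrite expr0n mul0e; transitivity (\int[P]_w (cst 0 w : \bar R))%E; last first.
    by rewrite integral0.
  apply: ae_eq_integral => //; first by apply/measurable_EFinP;
    exact: measurable_funX.
  by apply: filterS f0 => w -> _; rewrite expr0n.
have msq : measurable_fun [set: R] (fun x : R => (x ^+ 2)%:E).
  by apply/measurable_EFinP; exact: measurable_funX.
by rewrite (integral_law mf (nu := normal_prob 0 s) law msq) integral_normal_sqr.
Qed.

Lemma ae_eq0_cos f g b : measurable_fun [set: T] f -> measurable_fun [set: T] g ->
  {ae P, forall w, f w = 0} ->
  \int[P]_w cos (f w + g w + b) = \int[P]_w cos (g w + b).
Proof.
move=> mf mg f0; congr fine; apply: ae_eq_integral => //.
- apply: (measurableT_comp (measurable_cosD b)); exact: measurable_funD.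
- exact: (measurableT_comp (measurable_cosD b)).
- by apply: filterS f0 => w -> _; rewrite add0r.
Qed.

Lemma ae_eq0_cos_cst f b : measurable_fun [set: T] f ->
  {ae P, forall w, f w = 0} -> \int[P]_w cos (f w + b) = cos b.
Proof.
move=> mf f0; rewrite /Rintegral (ae_eq_integral (cst (cos b)%:E))//.
- by rewrite integral_cstP.
- exact: (measurableT_comp (measurable_cosD b)).
- by apply: filterS f0 => w -> _; rewrite add0r.
Qed.

Lemma normal_law_cosD f s b : measurable_fun [set: T] f -> has_normal_law f s ->
  \int[P]_w cos (f w + b) = cos b * \int[P]_w cos (f w).
Proof.
move=> mf; have -> : \int[P]_w cos (f w) = \int[P]_w cos (f w + 0).
  by apply: eq_Rintegral => w _; rewrite addr0.
case=> [[_ f0]|[s0 law]].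
  by rewrite !ae_eq0_cos_cst// cos0 mulr1.
rewrite /Rintegral !(integral_law mf (nu := normal_prob 0 s) law
  (measurable_cosD _)).
have := integral_normal_cosD 0 s0; rewrite cos0 mul1r /Rintegral => ->.
exact: integral_normal_cosD.
Qed.

Lemma normal_law_sqr_integrable f s : measurable_fun [set: T] f ->
  has_normal_law f s -> P.-integrable setT (EFin \o (fun w => f w ^+ 2)).
Proof.
move=> mf law; apply/integrableP; split.
  by apply/measurable_EFinP; exact: measurable_funX.
under eq_integral do rewrite /= ger0_norm ?sqr_ge0//.
rewrite (normal_law_sqr mf law).
have := normal_var1_lty (R := R); have := normal_var1_gt0 (R := R).
by case: normal_var1 => // r _ _; rewrite -EFinM ltry.
Qed.

Lemma integrable_mul f g : measurable_fun [set: T] f -> measurable_fun [set: T] g ->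
  P.-integrable setT (EFin \o (fun w => f w ^+ 2)) ->
  P.-integrable setT (EFin \o (fun w => g w ^+ 2)) ->
  P.-integrable setT (EFin \o (fun w => f w * g w)).
Proof.
move=> mf mg f2 g2; apply: le_integrable (integrableD measurableT f2 g2) => //.
  by apply/measurable_EFinP; exact: measurable_funM.
move=> w _ /=; rewrite lee_fin [leRHS]ger0_norm ?addr_ge0 ?sqr_ge0// ler_norml.
by apply/andP; split; nra.
Qed.

(** Uncorrelatedness makes second moments add, so the normal variable f + g has deviation sqrt (s1^2
    + s2^2), as an independent sum would. The left-hand side depends on the law of f + g alone and
    can thus be computed by convolution. *)
Lemma centered_normal_cosD f g b : centered_normal f -> centered_normal g ->
  centered_normal (fun w => f w + g w) -> \int[P]_w (f w * g w) = 0 ->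
  \int[P]_w cos (f w + g w + b) =
  cos b * (\int[P]_w cos (f w) * \int[P]_w cos (g w)).
Proof.
move=> cf cg cfg fg0.
have [mf _ _] := cf; have [mg _ _] := cg.
have [mfg _ _] := cfg.
have [s1 law1] := centered_normalP cf.
have [s2 law2] := centered_normalP cg.
have [s law] := centered_normalP cfg.
have cos_cst (h : T -> R) : measurable_fun [set: T] h ->
  {ae P, forall w, h w = 0} ->
    \int[P]_w cos (h w) = 1.
  move=> mh h0; rewrite -cos0 -(ae_eq0_cos_cst 0 mh h0).
  by apply: eq_Rintegral => w _; rewrite addr0.
(* Convolution asks for positive deviations; a degenerate summand is almost surely zero and drops
   out of the cosine. *)
have := law1; case=> [[_ f0]|[s10 plaw1]].
  by rewrite ae_eq0_cos// (normal_law_cosD b mg law2) (cos_cst f)// mul1r.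
have := law2; case=> [[_ g0]|[s20 plaw2]].
  rewrite (cos_cst g)// mulr1 -(normal_law_cosD b mf law1) -(ae_eq0_cos b mg mf g0).
  by apply: eq_Rintegral => w _; rewrite [g w + _]addrC.
have f2 := normal_law_sqr_integrable mf law1.
have g2 := normal_law_sqr_integrable mg law2.
have fg := integrable_mul mf mg f2 g2.
have k0 : 0 < fine (normal_var1 (R := R)).
  by rewrite fine_gt0// normal_var1_gt0 normal_var1_lty.
have sqrE (h : T -> R) t : measurable_fun [set: T] h -> has_normal_law h t ->
    \int[P]_w (h w ^+ 2) = t ^+ 2 * fine (normal_var1 (R := R)).
  move=> mh lawh; rewrite /Rintegral (normal_law_sqr mh lawh) fineM//.
  by rewrite ge0_fin_numE ?normal_var1_lty// ltW// normal_var1_gt0.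
have ss : s ^+ 2 = s1 ^+ 2 + s2 ^+ 2.
  apply: (mulIf (lt0r_neq0 k0)).
  rewrite mulrDl -(sqrE _ _ mfg law) -(sqrE _ _ mf law1) -(sqrE _ _ mg law2).
  have f2g2 := RintegralD measurableT f2 g2.
  have fg2 : P.-integrable setT (EFin \o (fun w => 2 * (f w * g w))).
    exact: (integrableZl measurableT 2 fg).
  have sum2 := RintegralD measurableT (integrableD measurableT f2 g2) fg2.
  have scal := RintegralZl 2 measurableT fg.
  rewrite -f2g2 -[RHS]addr0 -(mulr0 2) -fg0 -scal -sum2.
  by apply: eq_Rintegral => w _ /=; ring.
(* The sum cannot be degenerate, its squared deviation being a sum of two positive squares. *)
case: law => [[s0 _]|[s0 plaw]].
  by move: ss; rewrite s0 expr0n/=; have := exprn_gt0 2 s10;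
    have := exprn_gt0 2 s20; lra.
have sE : s = Num.sqrt (s1 ^+ 2 + s2 ^+ 2) by rewrite -ss sqrtr_sqr gtr0_norm.
have cfE (h : T -> R) t : measurable_fun [set: T] h ->
    (forall A, measurable A -> P (h @^-1` A) = normal_prob 0 t A) ->
    \int[P]_w cos (h w) = normal_cf t.
  move=> mh plawh; rewrite /normal_cf /Rintegral; congr fine.
  have E := integral_law mh (nu := normal_prob 0 t) plawh (measurable_cosD 0).
  apply: etrans (etrans E _); first by apply: eq_integral => w _; rewrite addr0.
  by apply: eq_integral => x _; rewrite addr0.
rewrite (cfE f s1)// (cfE g s2)// -integral_normal_conv_cosD// -sE.
by rewrite /Rintegral (integral_law mfg (nu := normal_prob 0 s) plaw
  (measurable_cosD b)).
Qed.

End CenteredGaussian.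

(** * Finite Gaussian families: linear combinations, covariance and regression *)

Section GaussianFamilies.
Context {dT : measure_display} {T : measurableType dT} {R : realType}.
Variable P : probability T R.
Implicit Types (f g : T -> R) (I J K : finType).

Definition lincomb J (X : J -> {RV P >-> R}) (a : J -> R) : T -> R :=
  fun w => \sum_j a j * X j w.

Definition inner f g := \int[P]_w (f w * g w).

Lemma measurable_lincomb J (X : J -> {RV P >-> R}) a :
  measurable_fun [set: T] (lincomb X a).
Proof. by apply: measurable_sum => j; exact: measurable_funM. Qed.

Lemma lincombD J (X : J -> {RV P >-> R}) a b w :
  lincomb X (fun j => a j + b j) w = lincomb X a w + lincomb X b w.
Proof. by rewrite -big_split; apply: eq_bigr => j _; rewrite mulrDl. Qed.

Lemma lincombZ J (X : J -> {RV P >-> R}) k a w :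
  lincomb X (fun j => k * a j) w = k * lincomb X a w.
Proof. by rewrite mulr_sumr; apply: eq_bigr => j _; rewrite mulrA. Qed.

Lemma lincomb0 J (X : J -> {RV P >-> R}) w : lincomb X (fun=> 0) w = 0.
Proof. by rewrite /lincomb big1// => j _; rewrite mul0r. Qed.

Lemma lincomb_delta J (X : J -> {RV P >-> R}) j w :
  lincomb X (fun i => (i == j)%:R) w = X j w.
Proof.
rewrite /lincomb (bigD1 j)//= eqxx mul1r big1 ?addr0// => i /negbTE ->.
by rewrite mul0r.
Qed.

Definition square_integrable f := measurable_fun [set: T] f /\
  P.-integrable setT (EFin \o (fun w => f w ^+ 2)).

Lemma centered_normal_square_integrable f : centered_normal P f ->
  square_integrable f.
Proof.
move=> cf; have [mf _ _] := cf; have [s law] := centered_normalP cf.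
by split => //; exact: normal_law_sqr_integrable law.
Qed.

Lemma square_integrable_mul f g : square_integrable f -> square_integrable g ->
  P.-integrable setT (EFin \o (fun w => f w * g w)).
Proof. by move=> [mf f2] [mg g2]; exact: integrable_mul. Qed.

Lemma square_integrable_integrable f : square_integrable f ->
  P.-integrable setT (EFin \o f).
Proof.
move=> sf; have s1 : square_integrable (cst 1).
  split; first exact: measurable_cst.
  rewrite (_ : _ \o _ = cst 1%:E); first exact: finite_measure_integrable_cst.
  by apply/funext => w /=; rewrite expr1n.
have := square_integrable_mul sf s1.
by rewrite (_ : (fun w => f w * cst 1 w) = f)//; apply/funext => w; rewrite mulr1.
Qed.

Lemma inner_lincombl J (X : J -> {RV P >-> R}) a g :
  (forall j, square_integrable (X j)) -> square_integrable g ->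
  inner (lincomb X a) g = \sum_j a j * inner (X j) g.
Proof.
move=> sX sg; have iXg j : P.-integrable setT (fun w => (a j * (X j w * g w))%:E).
  exact: (integrableZl measurableT (a j) (square_integrable_mul (sX j) sg)).
rewrite /inner /Rintegral.
rewrite (eq_integral (fun w => \sum_j (a j * (X j w * g w))%:E)%E); last first.
  move=> w _; rewrite sumEFin mulr_suml; congr (_%:E).
  by apply: eq_bigr => j _; rewrite mulrA.
rewrite integral_sum// -sum_fine; last by move=> j _; exact: integrable_fin_num.
apply: eq_bigr => j _.
exact: (RintegralZl (a j) measurableT (square_integrable_mul (sX j) sg)).
Qed.

Lemma innerC f g : inner f g = inner g f.
Proof. by apply: eq_Rintegral => w _; rewrite mulrC. Qed.

Lemma covariance_inner (X Y : {RV P >-> R}) : ('E_P[X] = 0)%E -> ('E_P[Y] = 0)%E ->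
  square_integrable X -> square_integrable Y ->
  covariance P X Y = (inner X Y)%:E.
Proof.
move=> X0 Y0 sX sY; rewrite covariance.unlock X0 Y0 expectation.unlock.
rewrite /inner fineK; last exact/integrable_fin_num/square_integrable_mul.
by apply: eq_integral => w _; rewrite !fctE/= !subr0.
Qed.

Section JointlyGaussian.
Variables (J : finType) (X : J -> {RV P >-> R}).
Hypothesis jX : jointly_gaussian X.
Hypothesis X0 : forall j, ('E_P[X j] = 0)%E.

Lemma centered_normal_coord j : centered_normal P (X j).
Proof.
split => //; last by have := X0 j; rewrite expectation.unlock.
have := jX (fun i => (i == j)%:R).
by rewrite (_ : (fun w => _) = X j)//; apply/funext => w; exact: lincomb_delta.
Qed.

Lemma square_integrable_coord j : square_integrable (X j).
Proof. exact/centered_normal_square_integrable/centered_normal_coord. Qed.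

Lemma centered_normal_lincomb a : centered_normal P (lincomb X a).
Proof.
split; [exact: measurable_lincomb|exact: jX|].
have iX j : P.-integrable setT (fun w => (a j * X j w)%:E).
  have iX := square_integrable_integrable (square_integrable_coord j).
  exact: (integrableZl measurableT (a j) iX).
rewrite (eq_integral (fun w => \sum_j (a j * X j w)%:E)%E); last first.
  by move=> w _; rewrite sumEFin.
rewrite integral_sum// big1// => j _.
have [_ _ E] := centered_normal_coord j.
under eq_integral do rewrite EFinM.
by rewrite integralZl ?E ?mule0//;
  exact/square_integrable_integrable/square_integrable_coord.
Qed.

Lemma square_integrable_lincomb a : square_integrable (lincomb X a).
Proof. exact/centered_normal_square_integrable/centered_normal_lincomb. Qed.

Lemma inner_lincomb a b : inner (lincomb X a) (lincomb X b) =
  \sum_i \sum_j a i * b j * inner (X i) (X j).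
Proof.
rewrite inner_lincombl//; [|exact: square_integrable_coord|
  exact: square_integrable_lincomb].
apply: eq_bigr => i _; rewrite innerC inner_lincombl//; last 2 first.
- exact: square_integrable_coord.
- exact: square_integrable_coord.
by rewrite mulr_sumr; apply: eq_bigr => j _; rewrite mulrA innerC.
Qed.

Lemma cov_mxE i j : cov_mx X i j = inner (X (enum_val i)) (X (enum_val j)).
Proof. by rewrite mxE covariance_inner//; exact: square_integrable_coord. Qed.

Lemma inner_eq0 f g : square_integrable f -> square_integrable g ->
  inner f f = 0 -> inner f g = 0.
Proof.
move=> sf sg ff0; have iff := square_integrable_mul sf sf.
have ff0' : (\int[P]_w `|(f w * f w)%:E| = 0)%E.
  under eq_integral do rewrite /= ger0_norm -?expr2 ?sqr_ge0//.
  by rewrite -[LHS]fineK ?(integrable_fin_num _ sf.2)//; congr (_%:E).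
have /(ae_eq_integral_abs P measurableT)  := ff0'.
move=> /(_ (measurable_int _ iff)) ae0.
rewrite /inner /Rintegral (ae_eq_integral (cst 0%E)) ?integral0//.
- exact: measurable_int (square_integrable_mul sf sg).
- apply: filterS ae0 => w /(_ I) /= [] /eqP; rewrite mulf_eq0 orbb => /eqP -> _.
  by rewrite mul0r.
Qed.

(** The covariance matrix is a Gram matrix, so its kernel consists of the combinations of zero
    variance: such a combination is orthogonal to every coordinate. This form of nonsingularity is
    free of the enumeration of [J]. *)
Lemma cov_mx_unitP : cov_mx X \in unitmx <->
  forall a, inner (lincomb X a) (lincomb X a) = 0 -> forall j, a j = 0.
Proof.
split=> [uC a aa0 j|def].
  pose v : 'rV[R]_#|J| := \row_i a (enum_val i).
  have : v *m cov_mx X = 0.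
    apply/rowP => k; rewrite !mxE.
    rewrite -[RHS](inner_eq0 (square_integrable_lincomb a)
      (square_integrable_coord (enum_val k)) aa0).
    rewrite inner_lincombl; [|exact: square_integrable_coord|
      exact: square_integrable_coord].
    rewrite (reindex (enum_val (A := J))) /=; last exact/onW_bij/enum_val_bij.
    by apply: eq_bigr => i _; rewrite cov_mxE mxE.
  move/(congr1 (fun M => M *m invmx (cov_mx X))); rewrite mulmxK// mul0mx => v0.
  by have /rowP/(_ (enum_rank j)) := v0; rewrite !mxE enum_rankK.
rewrite -row_free_unit -kermx_eq0; apply/rowV0P => v /sub_kermxP vC.
have H := def (fun j => v 0 (enum_rank j)).
apply/rowP => i; rewrite mxE -(enum_valK i); apply: H.
rewrite inner_lincomb.
have -> : \sum_i0 \sum_j v 0 (enum_rank i0) * v 0 (enum_rank j) * inner (X i0)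
  (X j) =
    (v *m cov_mx X *m v^T) 0 0.
  rewrite mxE (reindex (enum_rank (T := J)))/=; last exact/onW_bij/enum_rank_bij.
  rewrite exchange_big/=; apply: eq_bigr => j _; rewrite !mxE mulr_suml.
  rewrite [RHS](reindex (enum_rank (T := J)))/=; last exact/onW_bij/enum_rank_bij.
  by apply: eq_bigr => k _; rewrite cov_mxE !enum_rankK; ring.
by rewrite vC mul0mx mxE.
Qed.

End JointlyGaussian.

(** [B] rewrites the coefficients of a combination of [Y] as coefficients over [X], like the
    transpose of the map from [X] to [Y]; its trivial kernel transports definiteness of the
    covariance. *)
Lemma zmng_lincomb J (X : J -> {RV P >-> R}) I (Y : I -> {RV P >-> R})
    (B : (I -> R) -> J -> R) : zmng X ->
  (forall a w, lincomb Y a w = lincomb X (B a) w) ->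
  (forall a, (forall j, B a j = 0) -> forall i, a i = 0) -> zmng Y.
Proof.
move=> [jX X0 uX] YX B0.
have {}YX a : lincomb Y a = lincomb X (B a) by apply/funext => w.
have jY : jointly_gaussian Y by move=> a; rewrite -/(lincomb Y a) YX; exact: jX.
have Y0 i : ('E_P[Y i] = 0)%E.
  have [_ _ E] := centered_normal_lincomb jX X0 (B (fun k => (k == i)%:R)).
  rewrite expectation.unlock -[RHS]E; apply: eq_integral => w _.
  by rewrite -YX lincomb_delta.
split => //; apply/(cov_mx_unitP jY Y0) => a; rewrite YX => aa0.
by apply: B0 => j; exact: ((cov_mx_unitP jX X0).1 uX).
Qed.

(** [Y] and [Z] together are Gaussian because all their combinations are combinations of [X].
    Orthogonality of the coordinates extends to the two spans, which are the linear spaces that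
    [indep_sigma_rv] asks for. *)
Lemma indep_jointly_gaussian J (X : J -> {RV P >-> R}) I (Y : I -> {RV P >-> R})
    K (Z : K -> {RV P >-> R}) (B : (I -> R) -> (K -> R) -> J -> R) :
  jointly_gaussian X -> (forall j, ('E_P[X j] = 0)%E) ->
  (forall a b w, lincomb Y a w + lincomb Z b w = lincomb X (B a b) w) ->
  (forall i k, inner (Y i) (Z k) = 0) ->
  indep_sets P (sigma_rv (range (fun i => Y i : T -> R)))
    (sigma_rv (range (fun k => Z k : T -> R))).
Proof.
move=> jX X0 YZX YZ0.
have cYZ a b : centered_normal P (fun w => lincomb Y a w + lincomb Z b w).
  rewrite (_ : (fun w => _) = lincomb X (B a b)); last exact/funext/YZX.
  exact: centered_normal_lincomb.
have cY a : centered_normal P (lincomb Y a).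
  have := cYZ a (fun=> 0); rewrite (_ : (fun w => _) = lincomb Y a)//.
  by apply/funext => w; rewrite lincomb0 addr0.
have cZ b : centered_normal P (lincomb Z b).
  have := cYZ (fun=> 0) b; rewrite (_ : (fun w => _) = lincomb Z b)//.
  by apply/funext => w; rewrite lincomb0 add0r.
have sY i : square_integrable (Y i).
  apply: centered_normal_square_integrable.
  by have := cY (fun k => (k == i)%:R); rewrite (_ : lincomb _ _ = Y i)//;
    exact/funext/lincomb_delta.
have sZ k : square_integrable (Z k).
  apply: centered_normal_square_integrable.
  by have := cZ (fun i => (i == k)%:R); rewrite (_ : lincomb _ _ = Z k)//;
    exact/funext/lincomb_delta.
have spanP (M : finType) (U : M -> {RV P >-> R}) : range (fun i => U i : T ->
  R) `<=` range (lincomb U).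
  by move=> _ [i _ <-]; exists (fun k => (k == i)%:R) => //;
    exact/funext/lincomb_delta.
have span0 (M : finType) (U : M -> {RV P >-> R}) : range (lincomb U) (cst 0).
  by exists (fun=> 0) => //; exact/funext/lincomb0.
have spanD (M : finType) (U : M -> {RV P >-> R}) f g : range (lincomb U) f ->
    range (lincomb U) g -> range (lincomb U) (fun w => f w + g w).
  move=> [a _ <-] [b _ <-]; exists (fun j => a j + b j) => //;
    exact/funext/lincombD.
have spanZ (M : finType) (U : M -> {RV P >-> R}) k f : range (lincomb U) f ->
    range (lincomb U) (fun w => k * f w).
  by move=> [a _ <-]; exists (fun j => k * a j) => //; exact/funext/lincombZ.
have ind : indep_sets P (sigma_rv (range (lincomb Y))) (sigma_rv (range
  (lincomb Z))).
  apply: indep_sigma_rv => //.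
  - by move=> _ [a _ <-]; exact: measurable_lincomb.
  - by move=> _ [a _ <-]; exact: measurable_lincomb.
  - by move=> f g; split; exact: spanD.
  - by move=> k f; split; exact: spanZ.
  - move=> _ _ b [a _ <-] [a' _ <-]; apply: centered_normal_cosD => //.
    rewrite -/(inner (lincomb Y a) (lincomb Z a')) inner_lincombl//; last first.
      exact: centered_normal_square_integrable.
    rewrite big1// => i _; rewrite innerC inner_lincombl//.
    by rewrite big1 ?mulr0// => k _; rewrite innerC YZ0 mulr0.
by move=> A C YA ZC; apply: ind; [exact: sigma_rvS YA|exact: sigma_rvS ZC].
Qed.

Section Residual.
Variables (d : nat) (x z : 'I_d -> {RV P >-> R}) (G : 'M[R]_d).

Definition residual_fun i : T -> R := fun w => x i w - lincomb z (G i) w.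

Lemma measurable_residual i : measurable_fun [set: T] (residual_fun i).
Proof. by apply: measurable_funB => //; exact: measurable_lincomb. Qed.

Definition residual i : {RV P >-> R} :=
  HB.pack (residual_fun i) (isMeasurableFun.Build _ _ _ _ _
    (measurable_residual i)).

End Residual.

(* The regression matrix Cov(x, z) Cov(z)^-1. *)
Definition regression d (x z : 'I_d -> {RV P >-> R}) : 'M[R]_d :=
  \matrix_(i, j) ((\row_k inner (x i) (z (enum_val k))) *m
                  invmx (cov_mx z)) 0 (enum_rank j).

(** The normal equations of least squares: multiplying the regression matrix back by Cov(z) returns
    Cov(x, z). *)
Lemma inner_residual d (x z : 'I_d -> {RV P >-> R}) i l : zmng z ->
  (forall i, square_integrable (x i)) ->
  inner (residual x z (regression x z) i) (z l) = 0.
Proof.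
move=> [jz z0 uz] sx.
have sz j := square_integrable_coord jz z0 j.
have sl := square_integrable_lincomb jz z0 (regression x z i).
have E := RintegralB measurableT (square_integrable_mul (sx i) (sz l))
  (square_integrable_mul sl (sz l)).
rewrite /inner; under eq_Rintegral do rewrite /= /residual_fun mulrBl.
apply: (etrans E); rewrite -/(inner (x i) (z l)).
rewrite -/(inner (lincomb z (regression x z i)) (z l)) inner_lincombl//.
apply/eqP; rewrite subr_eq0; apply/eqP.
pose r : 'rV[R]_#|'I_d| := \row_k inner (x i) (z (enum_val k)).
transitivity ((r *m invmx (cov_mx z) *m cov_mx z) 0 (enum_rank l)).
  by rewrite mulmxKV// mxE enum_rankK.
rewrite mxE (reindex (enum_rank (T := 'I_d)))/=; last exact/onW_bij/enum_rank_bij.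
by apply: eq_bigr => j _; rewrite (cov_mxE jz z0) !enum_rankK [regression _ _ _
  _]mxE.
Qed.

End GaussianFamilies.

(** * Translation by a linear function of x_c *)

Section ConditionallyMarkov.
Context {dT : measure_display} {T : measurableType dT} {R : realType}.
Variable P : probability T R.
Variables (N d : nat) (c : 'I_N.+1) (x : 'I_N.+1 -> 'I_d -> {RV P >-> R}).
Hypothesis zx : zmng_seq x.

Let jx : jointly_gaussian (stack x) := let: And3 j _ _ := zx in j.
Let x0 : forall p, ('E_P[stack x p] = 0)%E := let: And3 _ e _ := zx in e.

Lemma lincomb_stack n (u : 'I_n -> 'I_d -> {RV P >-> R}) a w :
  lincomb (stack u) a w = \sum_k lincomb (u k) (fun i => a (k, i)) w.
Proof. by rewrite /lincomb pair_bigA; apply: eq_bigr => -[]. Qed.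

Lemma zmng_coords k : zmng (x k).
Proof.
apply: (zmng_lincomb (B := fun a p => if p.1 == k then a p.2 else 0) zx).
  move=> a w; rewrite lincomb_stack (bigD1 k)//= big1 ?addr0.
    by apply: eq_bigr => i _; rewrite eqxx.
  by move=> j /negbTE jk; rewrite /lincomb big1// => i _; rewrite /= jk mul0r.
by move=> a a0 i; have := a0 (k, i); rewrite /= eqxx.
Qed.

Section Translate.
Variable Gamma : 'I_N -> 'M[R]_d.

Definition translate k := residual (x (lift c k)) (x c) (Gamma k).

(** Subtracting [Gamma k] times x_c leaves the coefficients away from [c] unchanged, and all
    corrections collect at [c]. Hence the map has trivial kernel in [a], and the translate is
    nonsingular. *)
Definition translate_coef (a : 'I_N * 'I_d -> R) (b : 'I_d ->
  R) (p : 'I_N.+1 * 'I_d) :=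
  if unlift c p.1 is Some k then a (k, p.2)
  else b p.2 - \sum_k \sum_i a (k, i) * Gamma k i p.2.

Lemma lincomb_translate a b w : lincomb (stack translate) a w + lincomb (x c) b w =
  lincomb (stack x) (translate_coef a b) w.
Proof.
rewrite !lincomb_stack (bigD1_ord c)//= addrC.
have -> : lincomb (x c) (fun i => translate_coef a b (c, i)) w =
    lincomb (x c) b w - \sum_k \sum_i a (k, i) * lincomb (x c) (Gamma k i) w.
  rewrite /lincomb.
  rewrite (eq_bigr (fun j => b j * x c j w -
    \sum_k \sum_i a (k, i) * (Gamma k i j * x c j w))); last first.
    move=> j _; rewrite /translate_coef/= unlift_none mulrBl mulr_suml;
      congr (_ - _); apply: eq_bigr => k _.
    by rewrite mulr_suml; apply: eq_bigr => i _; rewrite mulrA.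
  rewrite sumrB exchange_big/=; congr (_ - _); apply: eq_bigr => k _.
  by rewrite exchange_big/=; apply: eq_bigr => i _; rewrite mulr_sumr.
rewrite [RHS]addrCA [LHS]addrC; congr (_ + _); rewrite -sumrB;
  apply: eq_bigr => k _.
rewrite /lincomb -sumrB; apply: eq_bigr => i _.
by rewrite /translate_coef liftK/= /residual_fun mulrBr.
Qed.

Lemma zmng_translate : zmng_seq translate.
Proof.
apply: (zmng_lincomb (B := fun a => translate_coef a (fun=> 0)) zx).
  by move=> a w; rewrite -lincomb_translate lincomb0 addr0.
by move=> a a0 [k i]; have := a0 (lift c k, i); rewrite /translate_coef liftK.
Qed.

(** Stated for any [Gamma] so as to serve both directions: with regression matrices when y is to be
    constructed, and with the matrices of a given representation. *)
Lemma CM_translate : (forall k, uncorrelated (translate k) (x c)) ->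
  CM c x <-> markov_seq translate.
Proof.
move=> unc; apply: (markov_given_translate (Gamma := Gamma)) => //.
have [jt t0 _] := zmng_translate; have [jc c0 _] := zmng_coords c.
have ind : indep_sets P (sigma_rv (range (fun p => stack translate p : T -> R)))
    (sigma_rv (coords (x c))).
  apply: (indep_jointly_gaussian (B := translate_coef) jx x0).
    exact: lincomb_translate.
  move=> [k i] j; apply: EFin_inj; rewrite -covariance_inner//.
  - exact: unc.
  - exact: (square_integrable_coord jt t0 (k, i)).
  - exact: (square_integrable_coord jc c0 j).
move=> A B tA cB; apply: ind => //; apply: sigma_rvS tA.
by move=> _ [k _ [i _ <-]]; exists (k, i).
Qed.

Lemma value_translate k w :
  value (x (lift c k)) w = value (translate k) w + Gamma k *m value (x c) w.
Proof.
apply/colP => i; rewrite !mxE /= /residual_fun /lincomb.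
by under [X in _ + X]eq_bigr do rewrite mxE; rewrite subrK.
Qed.

End Translate.

Lemma uncorrelated_translate_regression k :
  uncorrelated (translate (fun k => regression (x (lift c k)) (x c)) k) (x c).
Proof.
set G := fun k => _.
have [jt t0 _] := zmng_translate G; have [jc c0 _] := zmng_coords c.
move=> i j; rewrite covariance_inner//.
- rewrite inner_residual//; first exact: zmng_coords.
  by move=> l; exact: square_integrable_coord jx x0 (lift c k, l).
- exact: (t0 (k, i)).
- exact: (square_integrable_coord jt t0 (k, i)).
- exact: (square_integrable_coord jc c0 j).
Qed.

End ConditionallyMarkov.

Theorem proposition4p1 (dT : measure_display) (T : measurableType dT)
    (R : realType) (P : probability T R) (N d : nat) (c : 'I_N.+1)
    (x : 'I_N.+1 -> 'I_d -> {RV P >-> R}) :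
  (0 < N)%N ->
  c = ord0 \/ c = ord_max ->
  zmng_seq x ->
  CM c x <->
  exists (y : 'I_N -> 'I_d -> {RV P >-> R}) (Gamma : 'I_N -> 'M[R]_d),
    [/\ zmng_seq y,
        markov_seq y,
        zmng (x c),
        (forall k : 'I_N, uncorrelated (y k) (x c)) &
        (forall k : 'I_N, {ae P, forall w,
           value (x (lift c k)) w = value (y k) w + Gamma k *m value (x c) w})].
Proof.
move=> _ _ zx; split=> [CMx|[y [Gamma [zy My _ unc xyE]]]].
  pose Gamma k := regression (x (lift c k)) (x c).
  have unc := uncorrelated_translate_regression c zx.
  exists (translate c x Gamma), Gamma; split => //.
  - exact: zmng_translate.
  - exact/(CM_translate zx unc).
  - exact: zmng_coords.
  - by move=> k; apply: aeW => w; exact: value_translate.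
have [jy y0 _] := zy; have [jt t0 _] := zmng_translate c zx Gamma.
have [jc c0 _] := zmng_coords zx c.
(* The given y agrees almost surely with the translate by the same [Gamma], which therefore inherits
   both the Markov property and the zero covariance with x_c. *)
have yt k i : ae_eq P setT (y k i) (translate c x Gamma k i).
  apply: filterS (xyE k) => w; rewrite (value_translate c x Gamma) => E _.
  by have /colP/(_ i) := addIr _ E; rewrite !mxE.
apply/(CM_translate (Gamma := Gamma) zx); last exact: markov_seq_ae yt My.
move=> k i j.
have sy := square_integrable_coord jy y0 (k, i).
have st := square_integrable_coord jt t0 (k, i).
have sc := square_integrable_coord jc c0 j.
rewrite -(unc k i j) (covariance_inner (t0 (k, i)) (c0 j) st sc).
rewrite (covariance_inner (y0 (k, i)) (c0 j) sy sc); congr (_%:E).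
have [mi mi'] := (square_integrable_mul sy sc, square_integrable_mul st sc).
congr fine; apply: ae_eq_integral => //.
- exact: measurable_int mi'.
- exact: measurable_int mi.
- by apply: filterS (yt k i) => w /(_ I) E _; rewrite /stack /= E.
Qed.
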